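(* Let $F$ be a Finsler structure on a smooth manifold $M$. Suppose that for every $x,y\in M$ there is an absolutely continuous bi-geodesic (with respect to $F$) joining $x$ to $y$. For $t\in[0,1]$ put $F_t^a(x,v)=(1-t)F(x,v)+tF(x,-v)$ and $d(F)_t^a(x,y)=(1-t)\,d(F)(x,y)+t\,d(F)(y,x)$. Then for any $t\in[0,1]$ and all $x,y\in M$, $$d(F)_t^a(x,y)=d(F_t^a)(x,y).$$ In particular, $d(F)_t^a$ is a Finsler metric with Lagrangian $F_t^a$. Furthermore, every absolutely continuous bi-geodesic for $F$ is also a bi-geodesic for $F_t^a$.
   Context: A Finsler structure on a smooth manifold $M$ is a continuous function $F\colon TM\to[0,\infty)$ such that for every $x\in M$ the restriction $F(x,\cdot)$ to $T_xM$ is a weak norm, i.e. $F(x,v_1+v_2)\le F(x,v_1)+F(x,v_2)$ for all $v_1,v_2\in T_xM$; $F(x,\lambda v)=\lambda F(x,v)$ for all $\lambda\ge 0$ and $v\in T_xM$; and $F(x,v)=0$ if and only if $v=0$. (No symmetry and no further regularity is assumed.) For a Finsler structure $F$, the function $F_t^a$ is again a Finsler structure. The length of a piecewise $C^1$-path $\beta\colon[a,b]\to M$ is $l_F(\beta)=\int_a^bF(\beta(s),\dot\beta(s))\,ds$. The induced (possibly non-symmetric) metric $d(F)(x,y)$ is the infimum of $l_F(\beta)$ over all piecewise $C^1$-paths $\beta$ from $x$ to $y$ (also written $\delta(l_F)(x,y)$). A metric on $M$ is Finsler with Lagrangian $G$ if it equals $d(G)$ for the Finsler structure $G$. For a continuous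 path $\gamma\colon[a,b]\to M$, $l(d(F))(\gamma)$ is the supremum of $\sum_{i=0}^n d(F)(\gamma(t_i),\gamma(t_{i+1}))$ over all finite partitions $a=t_0\le t_1\le\dots\le t_{n+1}=b$. The path is a geodesic with respect to $F$ if it is continuous, $l(d(F))(\gamma)<\infty$ and $l(d(F))(\gamma)=d(F)(\gamma(a),\gamma(b))$. It is a bi-geodesic if both $\gamma$ and its reverse path $\gamma^{-1}$ are geodesics. A path $\gamma\colon[a,b]\to M$ is absolutely continuous if, for the distance $d$ of a Riemannian metric on $M$ (the notion does not depend on its choice), for every $\epsilon>0$ there is $\delta>0$ such that for any disjoint intervals $(a_1,b_1),\dots,(a_n,b_n)$ in $[a,b]$ of total length less than $\delta$ one has $\sum_i d(\gamma(a_i),\gamma(b_i))<\epsilon$. *)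

(* Defs.v *)
From HB Require Import structures.
From mathcomp Require Import all_boot all_order all_algebra.
From mathcomp Require Import all_classical all_reals all_analysis.

Set Implicit Arguments.
Unset Strict Implicit.
Unset Printing Implicit Defensive.

Import Order.TTheory GRing.Theory Num.Theory.
Import numFieldNormedType.Exports.
Local Open Scope classical_set_scope.
Local Open Scope ring_scope.

Section smooth_maps.
Context {R : realType} {V W : normedModType R}.

Fixpoint Ck_on (k : nat) (U : set V) (f : V -> W) : Prop :=
  match k with
  | 0 => forall x, U x -> {for x, continuous f}
  | k'.+1 => (forall x, U x -> differentiable f x) /\
             forall v, Ck_on k' U ('D_v f)
  end.

Definition smooth_on (U : set V) (f : V -> W) : Prop :=
  forall k, Ck_on k U f.

End smooth_maps.

Lemma near_eq_diff (R : realType) (V W : normedModType R) (f g : V -> W) x :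
  (\near x, f x = g x) -> differentiable g x -> 'd f x = 'd g x :> (V -> W).
Proof.
move=> fg dg; apply: diff_unique; first exact: diff_continuous.
have fx : f x = g x by exact: nbhs_singleton fg.
apply/eqaddoP => e e0.
have := diff_locally dg => /eqaddoP /(_ e e0).
have fg' : \forall h \near (0 : V), f (h + x) = g (h + x).
  have := fg; rewrite -{1}(add0r x) => fg0.
  have c : continuous (fun h : V => h + x).
    by move=> h; apply: cvgD; [exact: cvg_id|exact: cvg_cst].
  exact: (c 0 _ fg0).
apply: filter_app; near=> h.
rewrite /= !fctE /= fx.
suff -> : f (h + x) = g (h + x) by [].
by near: h.
Unshelve. all: by end_near. Qed.

(* [cmap] and [cinv] are total functions; only their values on [cdom] and
   [ccod] respectively are meaningful. *)
Record chart (R : realType) (n : nat) (M : topologicalType) := Chart {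
  cdom : set M;
  ccod : set 'rV[R]_n;
  cmap : M -> 'rV[R]_n;
  cinv : 'rV[R]_n -> M;
  cdom_open : open cdom;
  ccod_open : open ccod;
  cmap_ccod : forall x, cdom x -> ccod (cmap x);
  cinv_cdom : forall u, ccod u -> cdom (cinv u);
  cmapK : forall x, cdom x -> cinv (cmap x) = x;
  cinvK : forall u, ccod u -> cmap (cinv u) = u;
  cmap_continuous : {within cdom, continuous cmap};
  cinv_continuous : {within ccod, continuous cinv} }.

(* The atlas need not be maximal: the notions below do not change when charts
   smoothly compatible with it are added. *)
Record smoothManifold (R : realType) := SmoothManifold {
  msort :> topologicalType;
  mdim : nat;
  mhausdorff : hausdorff_space msort;
  msecond_countable : @second_countable msort;
  mindex : Type;
  matlas : mindex -> chart R mdim msort;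
  mcover : forall x, exists i, cdom (matlas i) x;
  mcompat : forall i j,
    smooth_on (ccod (matlas i) `&` cinv (matlas i) @^-1` cdom (matlas j))
              (cmap (matlas j) \o cinv (matlas i)) }.

Section tangent_space.
Context {R : realType} (M : smoothManifold R).
Local Notation n := (mdim M).
Local Notation I := (mindex M).

Definition transition (i j : I) : 'rV[R]_n -> 'rV[R]_n :=
  cmap (matlas j) \o cinv (matlas i).

(* A tangent vector at x is the family of its coordinates in the charts
   around x, related by the derivatives of the transition maps; the
   coordinates in the other charts are set to 0. *)
Definition is_tangent (x : M) (f : I -> 'rV[R]_n) : Prop :=
  (forall i, ~ cdom (matlas i) x -> f i = 0) /\
  (forall i j, cdom (matlas i) x -> cdom (matlas j) x ->
     f j = 'd (transition i j) (cmap (matlas i) x) (f i)).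

Definition tangent_pred (x : M) : {pred I -> 'rV[R]_n} :=
  fun f => `[< is_tangent x f >].

Lemma tangent_submod_closed (x : M) : submod_closed (tangent_pred x).
Proof.
split.
  by apply/asboolP; split=> [//|i j _ _]; rewrite linear0.
move=> a f g /asboolP[f0 fE] /asboolP[g0 gE]; apply/asboolP; split.
  move=> i xi; rewrite -[LHS]/(a *: f i + g i).
  by rewrite f0// g0// scaler0 addr0.
move=> i j xi xj.
rewrite -[LHS]/(a *: f j + g j) (fE i j)// (gE i j)//.
by rewrite -[(a *: f + g) i]/(a *: f i + g i) linearP.
Qed.

HB.instance Definition _ (x : M) :=
  GRing.isSubmodClosed.Build R _ (tangent_pred x) (tangent_submod_closed x).

Record tangent (x : M) := Tangent {
  tcoord : I -> 'rV[R]_n;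
  _ : tcoord \in tangent_pred x }.

HB.instance Definition _ (x : M) := [isSub for @tcoord x].
HB.instance Definition _ (x : M) := [Choice of tangent x by <:].
HB.instance Definition _ (x : M) :=
  [SubChoice_isSubLmodule of tangent x by <:].

End tangent_space.

Section transition_maps.
Context {R : realType} (M : smoothManifold R).
Local Notation A := (@matlas R M).

Lemma trans_open i j x : cdom (A i) x -> cdom (A j) x ->
  \forall u \near cmap (A i) x, ccod (A i) u /\ cdom (A j) (cinv (A i) u).
Proof.
move=> xi xj.
have ox := @cmap_ccod _ _ _ (A i) x xi.
have c := @cinv_continuous _ _ _ (A i).
have cc := @ccod_open _ _ _ (A i).
move: c; rewrite (continuous_open_subspace _ cc) => c.
apply: filterI; first exact: open_nbhs_nbhs.
have := c _ (mem_set ox); apply.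
by rewrite cmapK//; apply: open_nbhs_nbhs; split=> //; exact: cdom_open.
Qed.

Lemma trans_diff i j x : cdom (A i) x -> cdom (A j) x ->
  differentiable (transition i j) (cmap (A i) x).
Proof.
move=> xi xj; have [d _] := @mcompat _ M i j 1%N.
apply: d; split; first exact: cmap_ccod.
by rewrite /preimage/= cmapK.
Qed.

Lemma trans_cocycle i j k x v : cdom (A i) x -> cdom (A j) x -> cdom (A k) x ->
  'd (transition i k) (cmap (A i) x) v =
  'd (transition j k) (cmap (A j) x) ('d (transition i j) (cmap (A i) x) v).
Proof.
move=> xi xj xk.
have e : cmap (A j) x = transition i j (cmap (A i) x).
  by rewrite /transition /= cmapK.
have dij := trans_diff xi xj.
have djk : differentiable (transition j k) (transition i j (cmap (A i) x)).
  by rewrite -e; exact: trans_diff.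
transitivity ('d (transition j k \o transition i j) (cmap (A i) x) v); last first.
  transitivity (('d (transition j k) (transition i j (cmap (A i) x)) \o
     'd (transition i j) (cmap (A i) x)) v); last by rewrite /= -e.
  exact: (congr1 (@^~ v) (diff_comp dij djk)).
apply: (congr1 (@^~ v)); apply: near_eq_diff; last exact: differentiable_comp.
near=> u; rewrite /transition /= cmapK//.
by have [] : ccod (A i) u /\ cdom (A j) (cinv (A i) u) by near: u; exact: trans_open.
Unshelve. all: by end_near. Qed.

Definition coord_vector (i : mindex M) (x : M) (v : 'rV[R]_(mdim M)) :
    tangent x :=
  xget 0 [set w : tangent x | tcoord w i = v].

Lemma coord_vectorE i x v : cdom (A i) x -> tcoord (coord_vector i x v) i = v.
Proof.
move=> xi.
pose f j := if pselect (cdom (A j) x) then 'd (transition i j) (cmap (A i) x) v else 0.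
have ft : is_tangent x f.
  split=> [j nj|j k xj xk]; rewrite /f; first by case: pselect.
  by do 2 case: pselect => // ?; exact: trans_cocycle.
have fp : f \in tangent_pred x by apply/asboolP.
have : (exists w : tangent x, tcoord w i = v).
  exists (Tangent fp) => /=; rewrite /f; case: pselect => [hi|//].
  transitivity ('d (@id 'rV[R]_(mdim M)) (cmap (A i) x) v); last by rewrite diff_val.
  apply: (congr1 (fun h : 'rV_(mdim M) -> 'rV_(mdim M) => h v)).
  apply: near_eq_diff; last exact: ex_diff.
  near=> u; rewrite /transition /= cinvK//.
  by have [] : ccod (A i) u /\ cdom (A i) (cinv (A i) u) by near: u; exact: trans_open.
exact: xgetPex.
Unshelve. all: by end_near. Qed.
End transition_maps.

(* Not [{x & tangent x}]: the library gives sigma types the disjoint union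
   topology. *)
Record tangent_bundle (R : realType) (M : smoothManifold R) := TangentVector {
  tbase : M;
  tvec : tangent tbase }.

Section tangent_bundle_topology.
Context {R : realType} (M : smoothManifold R).
Local Notation TM := (tangent_bundle M).

HB.instance Definition _ := gen_eqMixin TM.
HB.instance Definition _ := gen_choiceMixin TM.

Definition bundle_chart (i : mindex M) (w : TM) :
    'rV[R]_(mdim M) * 'rV[R]_(mdim M) :=
  (cmap (matlas i) (tbase w), tcoord (tvec w) i).

Definition bundle_subbase : set (set TM) :=
  [set A | exists i, exists2 B, open B &
     A = [set w | cdom (matlas i) (tbase w) /\ B (bundle_chart i w)]].

HB.instance Definition _ :=
  @isSubBaseTopological.Build TM (set TM) bundle_subbase id.

End tangent_bundle_topology.

Section finsler.
Context {R : realType} (M : smoothManifold R).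
Implicit Types (F : forall x : M, tangent x -> R) (d : M -> M -> \bar R).

Record finsler_structure F : Prop := FinslerStructure {
  finsler_ge0 : forall x (v : tangent x), 0 <= F x v;
  finsler_continuous :
    continuous (fun w : tangent_bundle M => F (tbase w) (tvec w));
  finsler_subadditive :
    forall x (v1 v2 : tangent x), F x (v1 + v2) <= F x v1 + F x v2;
  finsler_homogeneous :
    forall x (l : R) (v : tangent x), 0 <= l -> F x (l *: v) = l * F x v;
  finsler_eq0 : forall x (v : tangent x), F x v = 0 <-> v = 0 }.

(* The difference quotient is restricted to the points of A, so that the
   derivative is one-sided at the endpoints of an interval A. *)
Definition is_velocity (A : set R) (beta : R -> M) (s : R)
    (v : tangent (beta s)) : Prop :=
  forall i, cdom (matlas i) (beta s) ->
    (fun u => (u - s)^-1 *: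
       (cmap (matlas i) (beta u) - cmap (matlas i) (beta s)))
      @ within A (s^') --> tcoord v i.

Arguments is_velocity : clear implicits.

Definition velocity (A : set R) (beta : R -> M) (s : R) : tangent (beta s) :=
  xget 0 [set v | is_velocity A beta s v].

Definition C1_path (a b : R) (beta : R -> M) : Prop :=
  exists (V : forall s, tangent (beta s)),
    (forall s, `[a, b]%classic s -> is_velocity `[a, b]%classic beta s (V s)) /\
    {within `[a, b]%classic, continuous (fun s => TangentVector (V s))}.

Definition piecewise_C1_path (a b : R) (beta : R -> M) : Prop :=
  {within `[a, b]%classic, continuous beta} /\
  exists (k : nat) (p : nat -> R),
    [/\ p 0%N = a, p k = b &
        forall i, (i < k)%N ->
          p i < p i.+1 /\ C1_path (p i) (p i.+1) beta].

(* At the finitely many points where [beta] has no derivative, [velocity] is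
   the default value 0; the integral does not depend on it. *)
Definition finsler_length F (a b : R) (beta : R -> M) : \bar R :=
  \int[lebesgue_measure]_(s in `[a, b]%classic)
    (F (beta s) (velocity `[a, b]%classic beta s))%:E.

(* +oo when no path joins x to y *)
Definition finsler_dist F (x y : M) : \bar R :=
  ereal_inf [set l | exists (a b : R) (beta : R -> M),
    [/\ a <= b, piecewise_C1_path a b beta, beta a = x, beta b = y &
        l = finsler_length F a b beta]].

Definition metric_length d (a b : R) (gamma : R -> M) : \bar R :=
  ereal_sup [set l | exists (k : nat) (p : nat -> R),
    [/\ p 0%N = a, p k.+1 = b, (forall i, (i <= k)%N -> p i <= p i.+1) &
        l = (\sum_(i < k.+1) d (gamma (p i)) (gamma (p i.+1)))%E]].

Definition geodesic F (a b : R) (gamma : R -> M) : Prop :=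
  [/\ {within `[a, b]%classic, continuous gamma},
      (metric_length (finsler_dist F) a b gamma < +oo)%E &
      metric_length (finsler_dist F) a b gamma =
        finsler_dist F (gamma a) (gamma b)].

Definition reverse_path (a b : R) (gamma : R -> M) : R -> M :=
  fun s => gamma (a + b - s).

Definition bi_geodesic F (a b : R) (gamma : R -> M) : Prop :=
  geodesic F a b gamma /\ geodesic F a b (reverse_path a b gamma).

Record riemannian_metric (g : forall x : M, tangent x -> tangent x -> R) :
    Prop := RiemannianMetric {
  riemannian_linear : forall x (l : R) (u v w : tangent x),
    g x (l *: u + v) w = l * g x u w + g x v w;
  riemannian_sym : forall x (u v : tangent x), g x u v = g x v u;
  riemannian_pos : forall x (v : tangent x), v != 0 -> 0 < g x v v;
  riemannian_smooth : forall i (v w : 'rV[R]_(mdim M)),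
    smooth_on (ccod (matlas i))
      (fun u => let x := cinv (matlas i) u in
                g x (coord_vector i x v) (coord_vector i x w)) }.

Definition riemannian_dist (g : forall x : M, tangent x -> tangent x -> R) :
    M -> M -> \bar R :=
  finsler_dist (fun x v => Num.sqrt (g x v v)).

Definition abs_continuous_path (a b : R) (gamma : R -> M) : Prop :=
  exists2 g, riemannian_metric g &
    forall e : R, 0 < e -> exists2 delta : R, 0 < delta &
      forall (k : nat) (u v : 'I_k -> R),
        (forall i, [/\ a <= u i, u i < v i & v i <= b]) ->
        (forall i j, i != j ->
           `]u i, v i[%classic `&` `]u j, v j[%classic = set0) ->
        \sum_i (v i - u i) < delta ->
        (\sum_i riemannian_dist g (gamma (u i)) (gamma (v i)) < e%:E)%E.

(* d need not be symmetric *)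
Definition is_metric d : Prop :=
  [/\ (forall x y, d x y \is a fin_num),
      (forall x y, (0 <= d x y)%E),
      (forall x y, d x y = 0%E <-> x = y) &
      (forall x y z, (d x z <= d x y + d y z)%E)].

Definition finsler_metric_with_lagrangian d F : Prop :=
  [/\ is_metric d, finsler_structure F &
      forall x y, d x y = finsler_dist F x y].

Definition asym_structure (t : R) F : forall x : M, tangent x -> R :=
  fun x v => (1 - t) * F x v + t * F x (- v).

Definition asym_metric (t : R) d : M -> M -> \bar R :=
  fun x y => ((1 - t)%:E * d x y + t%:E * d y x)%E.

End finsler.

(* Main.v *)
Require Import Defs.
From mathcomp Require Import all_boot all_order all_algebra.
From mathcomp Require Import all_classical all_reals all_analysis.
From mathcomp Require Import finmap measurable_realfun ring lra.
Import Order.TTheory GRing.Theory Num.Theory.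
Import numFieldNormedType.Exports.
Local Open Scope classical_set_scope.
Local Open Scope ring_scope.

(** Write [d] for the distance of [F], [Ft] for the combined structure, [dt]
    for its distance, and [T x y] for the combination
    [(1 - t) d(x, y) + t d(y, x)]; the claim is that [dt = T].  The proof
    compares [dt] and [T] locally.

    In a chart around a point [p], let [N] be the weak norm that a Finsler
    structure induces on coordinate vectors at [p].  By continuity and
    compactness of the unit sphere, the weak norms at nearby points differ
    from [N] by at most [e N] ([chart_norm_near]).  A coordinate segment then
    bounds the distance from above by [(1 + e) N(y - x)]
    ([finsler_dist_segment]).  Conversely a path that stays in a small
    coordinate ball has length at least [1 - e] times the norm of its chord
    ([path_length_chord]), and a path that leaves a ball centred at [p] is
    longer than that when its ends are close enough to [p]
    ([path_length_exit]).  So near [p] the distance from [x] to [y] lies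
    between [(1 - e) N(y - x)] and [(1 + e) N(y - x)]
    ([finsler_dist_local]).

    If [N] is the weak norm of [F] at [p], that of [Ft] is
    [(1 - t) N(v) + t N(-v)].  Applying the
    local estimate to [F], in both directions, and to [Ft] shows that [dt] and
    [T] agree near every point up to a factor close to 1 ([asym_local]).

    It remains to pass from small to large distances, by an induction along
    paths ([real_induction]).  Lengths of paths are additive and [T] satisfies
    the triangle inequality, so [T x y] is at most the [Ft]-length of every
    path from [x] to [y] ([asym_le_path]); hence [T <= dt].  Along a
    bi-geodesic of [F] both [d(x, y)] and [d(y, x)] are additive, hence so is
    [T], while [dt] satisfies the triangle inequality; hence [dt <= T] at its
    endpoints ([dist_le_asym]).  Finally, additivity of [T = dt] along a
    bi-geodesic of [F] says that it is a geodesic of [Ft], and the same applies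
    to the reverse path ([bi_geodesic_asym]). *)

Set Implicit Arguments.
Unset Strict Implicit.
Unset Printing Implicit Defensive.

(** * Induction along a real interval *)

(** A property that holds at [a], passes from nearby points on the left to
    each [s], and from each [s] to nearby points on the right, holds at [b]. *)
Lemma real_induction (R : realType) (P : R -> Prop) (a b : R) :
  a <= b -> P a ->
  (forall s, a <= s <= b -> exists2 e, 0 < e &
     forall u, a <= u <= b -> `|u - s| < e ->
       (u <= s -> P u -> P s) /\ (s <= u -> P s -> P u)) ->
  P b.
Proof.
move=> ab Pa step.
pose S := [set s | a <= s <= b /\ P s].
have Sa : S a by split=> //; rewrite lexx.
have Sb : ubound S b by move=> s [/andP[]].
have supS : has_sup S by split; [exists a|exists b].
have sab : a <= sup S <= b.
  by rewrite (ub_le_sup supS.2 Sa) /= ge_sup//; exists a.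
have [e e0 he] := step _ sab.
have [s [sab' Ps] es] := sup_adherent e0 supS.
have ss : s <= sup S by apply: (ub_le_sup supS.2); split.
have Psup : P (sup S).
  apply: (he s sab' _).1 => //.
  by rewrite ler0_norm ?subr_le0// opprB ltrBlDr -ltrBlDl.
have /andP[as_] := sab; rewrite le_eqVlt => /orP[/eqP <- //|sb'].
pose u := Num.min b (sup S + e / 2).
have su : sup S < u by rewrite lt_min sb' ltrDl divr_gt0.
have uab : a <= u <= b.
  by rewrite (le_trans as_ (ltW su)) /= /u ge_min lexx.
have Su : S u.
  split=> //; apply: (he u uab _).2 => //; last exact: ltW.
  rewrite gtr0_norm ?subr_gt0// ltrBlDl gt_min; apply/orP; right.
  by rewrite ltrD2l ltr_pdivrMr// ltr_pMr// ltr1n.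
by have := ub_le_sup supS.2 Su; rewrite leNgt su.
Qed.

(** * Tangent vectors in coordinates *)

Section tangent_coordinates.
Context {R : realType} (M : smoothManifold R).
Local Notation A := (@matlas R M).
Implicit Types (x : M) (i j : mindex M).

Lemma tcoordP x (v : tangent x) : is_tangent x (tcoord v).
Proof. by case: v => f /= /asboolP. Qed.

Lemma tcoordZ x (l : R) (v : tangent x) i : tcoord (l *: v) i = l *: tcoord v i.
Proof. by []. Qed.

Lemma tcoordD x (v w : tangent x) i :
  tcoord (v + w) i = tcoord v i + tcoord w i.
Proof. by []. Qed.

Lemma tcoordN x (v : tangent x) i : tcoord (- v) i = - tcoord v i.
Proof. by []. Qed.

Lemma tcoord0 x i : tcoord (0 : tangent x) i = 0.
Proof. by []. Qed.

(** A tangent vector is determined by its coordinates in one chart. *)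
Lemma tcoord_inj i x (v w : tangent x) :
  cdom (A i) x -> tcoord v i = tcoord w i -> v = w.
Proof.
move=> xi vw; apply/val_inj/funext => j /=.
have [v0 vE] := tcoordP v; have [w0 wE] := tcoordP w.
have [xj|nxj] := pselect (cdom (A j) x); last by rewrite v0// w0.
by rewrite (vE i j xi xj) (wE i j xi xj) vw.
Qed.

Lemma tcoord_trans i j x (v : tangent x) : cdom (A i) x -> cdom (A j) x ->
  tcoord v j = 'd (transition i j) (cmap (A i) x) (tcoord v i).
Proof. by move=> xi xj; have [_] := tcoordP v; apply. Qed.

Lemma tcoordK i x (v : tangent x) :
  cdom (A i) x -> coord_vector i x (tcoord v i) = v.
Proof. by move=> xi; apply: (@tcoord_inj i) => //; rewrite coord_vectorE. Qed.

Lemma coord_vectorZ i x (l : R) u :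
  cdom (A i) x -> coord_vector i x (l *: u) = l *: coord_vector i x u.
Proof.
by move=> xi; apply: (@tcoord_inj i) => //; rewrite tcoordZ !coord_vectorE.
Qed.

Lemma coord_vectorD i x u v : cdom (A i) x ->
  coord_vector i x (u + v) = coord_vector i x u + coord_vector i x v.
Proof.
by move=> xi; apply: (@tcoord_inj i) => //; rewrite tcoordD !coord_vectorE.
Qed.

Lemma coord_vectorN i x u : cdom (A i) x ->
  coord_vector i x (- u) = - coord_vector i x u.
Proof.
by move=> xi; apply: (@tcoord_inj i) => //; rewrite tcoordN !coord_vectorE.
Qed.

Lemma coord_vector_eq0 i x u : cdom (A i) x ->
  coord_vector i x u = 0 -> u = 0.
Proof.
move=> xi /(congr1 (fun w : tangent x => tcoord w i)).
by rewrite coord_vectorE// tcoord0.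
Qed.

Lemma cmap_cvg i x : cdom (A i) x -> {for x, continuous (cmap (A i))}.
Proof.
move=> xi; have := @cmap_continuous _ _ _ (A i).
rewrite (continuous_open_subspace _ (@cdom_open _ _ _ _)); apply.
exact: mem_set.
Qed.

Lemma cinv_cvg i u : ccod (A i) u -> {for u, continuous (cinv (A i))}.
Proof.
move=> ui; have := @cinv_continuous _ _ _ (A i).
rewrite (continuous_open_subspace _ (@ccod_open _ _ _ _)); apply.
exact: mem_set.
Qed.

Lemma cdom_nbhs i x : cdom (A i) x -> nbhs x (cdom (A i)).
Proof. by move=> xi; apply: open_nbhs_nbhs; split=> //; exact: cdom_open. Qed.

Lemma ccod_nbhs i u : ccod (A i) u -> nbhs u (ccod (A i)).
Proof. by move=> xi; apply: open_nbhs_nbhs; split=> //; exact: ccod_open. Qed.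

(** * The topology of the tangent bundle *)

Local Notation TM := (tangent_bundle M).

Lemma bundle_subbase_open (B : set TM) : @bundle_subbase R M B -> open B.
Proof.
move=> subB; exists [set B]; last by rewrite bigcup_set1.
move=> _ ->; exists [fset B]%fset.
  by move=> C; rewrite inE => /eqP ->; exact: mem_set.
by rewrite set_fset1 bigcap_set1.
Qed.

Lemma bundle_cdom_nbhs i (w : TM) :
  cdom (A i) (tbase w) -> \forall w' \near w, cdom (A i) (tbase w').
Proof.
move=> wi.
have : nbhs w [set w' | cdom (A i) (tbase w') /\ setT (bundle_chart i w')].
  apply: open_nbhs_nbhs; split => //; apply: bundle_subbase_open.
  by exists i, setT => //; exact: openT.
by apply: filterS => w' [].
Qed.

Lemma bundle_chart_cvg i (w : TM) :
  cdom (A i) (tbase w) -> {for w, continuous (bundle_chart i)}.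
Proof.
move=> wi B; rewrite nbhsE => -[C [oC Cw] CB].
have : nbhs w [set w' | cdom (A i) (tbase w') /\ C (bundle_chart i w')].
  apply: open_nbhs_nbhs; split => //; apply: bundle_subbase_open.
  by exists i, C.
by apply: filterS => w' [_ /CB].
Qed.

(** Convergence in the tangent bundle is convergence in every bundle chart
    around the limit. *)
Lemma cvg_bundle (T : Type) (Fi : set_system T) (f : T -> TM) (w : TM) :
  Filter Fi ->
  (forall i, cdom (A i) (tbase w) ->
     (\forall x \near Fi, cdom (A i) (tbase (f x))) /\
     bundle_chart i (f x) @[x --> Fi] --> bundle_chart i w) ->
  f @ Fi --> w.
Proof.
move=> FF fw B; rewrite nbhsE => -[C [[D Dsub <-] [E DE Ew]] CB].
have [G Gsub GE] := Dsub _ DE.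
suff GF : \forall x \near Fi, E (f x).
  by apply: filterS GF => x Ex; apply: CB; exists E.
rewrite -GE; apply: filter_bigI => H HG.
have /set_mem [i [U oU HE]] := Gsub _ HG.
have : H w by move: Ew; rewrite -GE; apply.
rewrite HE => -[wi Uw]; have [fi fU] := fw i wi.
near=> x; split; first by near: x.
by near: x; apply: fU; apply: open_nbhs_nbhs.
Unshelve. all: by end_near. Qed.

Lemma bundle_opp_continuous :
  continuous (fun w : TM => TangentVector (- tvec w)).
Proof.
move=> w; apply: (cvg_bundle (nbhs_filter w)) => i /= wi.
split; first exact: bundle_cdom_nbhs.
have c := bundle_chart_cvg wi.
have c1 : (bundle_chart i w').1 @[w' --> w] --> (bundle_chart i w).1.
  exact: (cvg_comp _ _ c (@cvg_fst _ _ _ _ _)).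
have c2 : (bundle_chart i w').2 @[w' --> w] --> (bundle_chart i w).2.
  exact: (cvg_comp _ _ c (@cvg_snd _ _ _ _ _)).
exact: (cvg_pair c1 (cvgN c2)).
Qed.

End tangent_coordinates.

Lemma near_eq_continuous (S T : topologicalType) (f g : S -> T) x :
  (\forall y \near x, f y = g y) -> {for x, continuous g} ->
  {for x, continuous f}.
Proof.
move=> fg cg; rewrite /prop_for /continuous_at (nbhs_singleton fg).
by apply: cvg_trans cg; apply: near_eq_cvg; apply: filterS fg => y ->.
Qed.

Section frames.
Context {R : realType} (M : smoothManifold R).
Local Notation A := (@matlas R M).
Local Notation rV := 'rV[R]_(mdim M).

(** The derivative of a transition map is jointly continuous in the point and
    the vector, since it is a combination of partial derivatives. *)
Lemma diff_transition_cvg i j (u v : rV) :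
  ccod (A i) u -> cdom (A j) (cinv (A i) u) ->
  {for (u, v), continuous (fun p : rV * rV => 'd (transition i j) (p.1) p.2)}.
Proof.
move=> ui uj.
have cf : cinv (A i) p.1 @[p --> (u, v)] --> cinv (A i) u.
  apply: (cvg_comp (@fst rV rV) (cinv (A i)) _ (@cinv_cvg _ _ i u ui)).
  exact: cvg_fst.
have [d dD] := @mcompat _ M i j 1%N.
have E p : ccod (A i) p.1 -> cdom (A j) (cinv (A i) p.1) ->
    'd (transition i j) (p.1) p.2 =
    \sum_k p.2 0 k *: 'D_(delta_mx 0 k) (transition i j) p.1.
  move=> pi pj; rewrite {1}(row_sum_delta p.2) linear_sum.
  apply: eq_bigr => k _.
  by rewrite linearZ deriveE//; apply: d.
apply: (@near_eq_continuous (rV * rV)%type rV _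
  (fun p => \sum_k p.2 0 k *: 'D_(delta_mx 0 k) (transition i j) p.1)).
  near=> p; apply: E; near: p.
    by apply: cvg_fst; exact: ccod_nbhs.
  exact: (cf _ (cdom_nbhs uj)).
apply: cvg_big; first exact: add_continuous.
move=> k _; apply: cvgZ.
  apply: (cvg_comp (@snd rV rV) (fun w : rV => w 0 k)); first exact: cvg_snd.
  exact: coord_continuous.
apply: (cvg_comp (@fst rV rV) ('D_(delta_mx 0 k) (transition i j))).
  exact: cvg_fst.
exact: dD.
Unshelve. all: by end_near. Qed.

(** The local trivialisation of the tangent bundle given by a chart is
    continuous. *)
Lemma frame_cvg i (u v : rV) : ccod (A i) u ->
  {for (u, v), continuous (fun p : rV * rV =>
     TangentVector (coord_vector i (cinv (A i) p.1) p.2))}.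
Proof.
move=> ui; apply: (cvg_bundle (nbhs_filter (u, v))) => j /= uj.
have cf : cinv (A i) p.1 @[p --> (u, v)] --> cinv (A i) u.
  apply: (cvg_comp (@fst rV rV) (cinv (A i)) _ (@cinv_cvg _ _ i u ui)).
  exact: cvg_fst.
split; first exact: (cf _ (cdom_nbhs uj)).
have c1 : cmap (A j) (cinv (A i) p.1) @[p --> (u, v)] -->
    cmap (A j) (cinv (A i) u).
  exact: (cvg_comp _ (cmap (A j)) cf (cmap_cvg uj)).
have E p : ccod (A i) p.1 -> cdom (A j) (cinv (A i) p.1) ->
    tcoord (coord_vector i (cinv (A i) p.1) p.2) j =
    'd (transition i j) (p.1) p.2.
  move=> pi pj; have pc := cinv_cdom pi.
  apply: (etrans (tcoord_trans _ pc pj)).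
  by rewrite (coord_vectorE p.2 pc) (cinvK pi).
have c2 : {for (u, v), continuous (fun p : rV * rV =>
    tcoord (coord_vector i (cinv (A i) p.1) p.2) j)}.
  apply: (@near_eq_continuous (rV * rV)%type rV _ _ _ _
    (diff_transition_cvg (v := v) ui uj)).
  near=> p; apply: E; near: p.
    by apply: cvg_fst; exact: ccod_nbhs.
  exact: (cf _ (cdom_nbhs uj)).
exact: (cvg_pair c1 c2).
Unshelve. all: by end_near. Qed.

End frames.

(** * Velocities and piecewise C1 paths *)

Lemma within_continuousP (T S : topologicalType) (B : set T) (f : T -> S) :
  {within B, continuous f} <->
  forall x, B x -> f y @[y --> within B (nbhs x)] --> f x.
Proof. exact: subspace_continuousP. Qed.

Section paths.
Context {R : realType} (M : smoothManifold R).
Local Notation A := (@matlas R M).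
Implicit Types (beta : R -> M) (a b c s : R).

Lemma within_itv_proper a b s : a < b -> a <= s <= b ->
  ProperFilter (within `[a, b]%classic (s^')).
Proof.
move=> ab /andP[as_ sb]; split; last first.
  by apply: within_filter; exact: dnbhs_filter.
rewrite /within /= /dnbhs /within /= => /nbhs_ballP[e /= e0 he].
have [sb'|bs] := ltP s b.
  pose u := Num.min b (s + e / 2).
  have su : s < u by rewrite lt_min sb' ltrDl divr_gt0.
  apply: (he u); rewrite /ball /= ?gt_eqF//.
    rewrite ltr0_norm ?subr_lt0// opprB ltrBlDl gt_min; apply/orP; right.
    by rewrite ltrD2l ltr_pdivrMr// ltr_pMr// ltr1n.
  by rewrite in_itv/= (le_trans as_ (ltW su)) /u ge_min lexx.
pose u := Num.max a (s - e / 2).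
have a_s : a < s by apply: lt_le_trans bs.
have us : u < s by rewrite gt_max a_s ltrBlDr ltrDl divr_gt0.
apply: (he u); rewrite /ball /= ?lt_eqF//.
  rewrite gtr0_norm ?subr_gt0// ltrBlDl -ltrBlDr lt_max; apply/orP; right.
  by rewrite ltrD2l ltrN2 ltr_pdivrMr// ltr_pMr// ltr1n.
by rewrite in_itv/= (le_trans (ltW us) sb) /u le_max lexx.
Qed.

Lemma is_velocity_sub (B C : set R) beta s v : B `<=` C ->
  @is_velocity R M C beta s v -> @is_velocity R M B beta s v.
Proof.
move=> BC vC i si; apply: cvg_trans (vC i si); apply: cvg_app.
exact: (within_subset (dnbhs_filter s)).
Qed.

Lemma is_velocity_unique (B : set R) beta s v w :
  ProperFilter (within B (s^')) ->
  @is_velocity R M B beta s v -> @is_velocity R M B beta s w -> v = w.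
Proof.
move=> PF vv ww; have [i si] := mcover (beta s).
apply: (tcoord_inj si); apply: (cvg_unique _ (vv i si) (ww i si)).
exact: norm_hausdorff.
Qed.

Lemma velocityE (B : set R) beta s v :
  ProperFilter (within B (s^')) ->
  @is_velocity R M B beta s v -> velocity B beta s = v.
Proof.
by move=> PF vv; apply: xget_unique => // w ww; exact: is_velocity_unique ww vv.
Qed.

Lemma within_itv_interior a b s : a < s < b ->
  within `[a, b]%classic (s^') = s^'.
Proof.
move=> asb; apply/seteqP; split => E; last first.
  by rewrite /within /=; apply: filterS => u Eu _.
rewrite /within /=.
have H : nbhs s [set u | `[a, b]%classic u].
  have sI : s \in `]a, b[ by rewrite in_itv.
  by apply: filterS (near_in_itvoo sI) => u; exact: subset_itv_oo_cc.
rewrite /dnbhs /within /=; apply: filterS2 H => u uab h us; exact: h.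
Qed.

Lemma velocity_interior a b beta s : a < s < b ->
  velocity `[a, b]%classic beta s = velocity setT beta s :> tangent (beta s).
Proof.
move=> asb; congr (xget 0 _); apply/seteqP; split => v /= vv i si.
  by rewrite withinET -(within_itv_interior asb); exact: vv.
by rewrite (within_itv_interior asb) -[s^']withinET; exact: vv.
Qed.

(** The velocity field of a C1 path as a curve in the tangent bundle. The type
    of the curve does not mention the path, so that it can be transported along
    a pointwise equality of paths. *)
Lemma C1_pathP a b beta :
  C1_path a b beta <->
  exists2 W : R -> tangent_bundle M,
    {within `[a, b]%classic, continuous W} &
    forall s, a <= s <= b -> tbase (W s) = beta s /\
      forall i, cdom (A i) (beta s) ->
        (fun u => (u - s)^-1 *: (cmap (A i) (beta u) - cmap (A i) (beta s)))
          @ within `[a, b]%classic (s^') --> tcoord (tvec (W s)) i.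
Proof.
split=> [[V [Vv cV]]|[W cW WP]].
  exists (fun s => TangentVector (V s)) => // s sab; split=> //= i si.
  by apply: Vv => //; rewrite /= in_itv.
have HV s : exists v : tangent (beta s), a <= s <= b -> TangentVector v = W s.
  have [sab|nsab] := boolP (a <= s <= b); last by exists 0.
  have [] := WP s sab; case: (W s) => x v /= xs _.
  by rewrite -xs; exists v.
pose V s := projT1 (cid (HV s)).
have VE s : a <= s <= b -> TangentVector (V s) = W s.
  by rewrite /V; case: cid.
exists V; split.
  move=> s; rewrite /= in_itv /= => sab i si.
  have := (WP s sab).2 i si; rewrite -(VE s sab); exact.
apply: subspace_eq_continuous cW => s /set_mem; rewrite /= in_itv /= => sab.
by rewrite /from_subspace VE.
Qed.

Lemma C1_path_sub a b c d beta : a <= c -> d <= b ->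
  C1_path a b beta -> C1_path c d beta.
Proof.
move=> ac db [V [Vv cV]].
have sub : `[c, d]%classic `<=` `[a, b]%classic.
  move=> s; rewrite /= !in_itv /= => /andP[cs sd].
  by rewrite (le_trans ac cs) (le_trans sd db).
exists V; split; last exact: (continuous_subspaceW sub).
by move=> s /sub sab; apply: (is_velocity_sub sub); exact: Vv.
Qed.

Lemma C1_path_ext a b beta beta' :
  (forall s, a <= s <= b -> beta s = beta' s) ->
  C1_path a b beta -> C1_path a b beta'.
Proof.
move=> bb' /C1_pathP[W cW WP]; apply/C1_pathP; exists W => // s sab.
have [Ws Wv] := WP s sab; split; first by rewrite Ws bb'.
move=> i; rewrite -bb'// => si; apply: cvg_trans (Wv i si).
apply: near_eq_cvg.
apply: filterS (withinT `[a, b]%classic (dnbhs_filter s)) => u.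
by rewrite /= in_itv /= => uab; rewrite !bb'.
Qed.

Lemma within_shift (B : set R) c s :
  u + c @[u --> within [set u | B (u + c)] (s^')] = within B ((s + c)^').
Proof.
apply/seteqP; split => E H.
  have cc : u - c @[u --> s + c] --> s.
    by rewrite -{2}(addrK c s); apply: cvgB; [exact: cvg_id|exact: cvg_cst].
  have H' : nbhs (s + c)
    [set u | u - c != s -> B (u - c + c) -> E (u - c + c)] := cc _ H.
  change (nbhs (s + c) [set u | u != s + c -> B u -> E u]).
  by apply: filterS H' => u /=; rewrite subrK subr_eq.
have cc : u + c @[u --> s] --> s + c.
  by apply: cvgD; [exact: cvg_id|exact: cvg_cst].
have H' : nbhs s [set u | u + c != s + c -> B (u + c) -> E (u + c)] := cc _ H.
change (nbhs s [set u | u != s -> B (u + c) -> E (u + c)]).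
by apply: filterS H' => u /=; rewrite (inj_eq (addIr c)).
Qed.

Lemma is_velocity_shift (B : set R) beta c s v :
  @is_velocity R M [set u | B (u + c)] (fun u => beta (u + c)) s v <->
  @is_velocity R M B beta (s + c) v.
Proof.
rewrite /is_velocity -within_shift.
have E i : (fun u => (u - s)^-1 *:
      (cmap (A i) (beta (u + c)) - cmap (A i) (beta (s + c)))) =
    (fun w => (w - (s + c))^-1 *:
      (cmap (A i) (beta w) - cmap (A i) (beta (s + c)))) \o (fun u => u + c).
  by apply/funext => u /=; rewrite opprD addrACA subrr addr0.
by split => vv i si; move: (vv i si); rewrite E.
Qed.

Lemma velocity_shift beta c s :
  velocity setT (fun u => beta (u + c)) s =
  velocity setT beta (s + c) :> tangent (beta (s + c)).
Proof.
congr (xget 0 _); apply/seteqP; split => v hv;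
  [exact: (@is_velocity_shift setT beta c s v).1 hv
  |exact: (@is_velocity_shift setT beta c s v).2 hv].
Qed.

Lemma within_shift_cvg (B : set R) c s :
  u + c @[u --> within [set u | B (u + c)] (nbhs s)] -->
  within B (nbhs (s + c)).
Proof.
move=> D H; have cc : u + c @[u --> s] --> s + c.
  by apply: cvgD; [exact: cvg_id|exact: cvg_cst].
exact: (cc _ H).
Qed.

Lemma C1_path_shift a b c beta : C1_path a b beta ->
  C1_path (a - c) (b - c) (fun u => beta (u + c)).
Proof.
have E : `[a - c, b - c]%classic = [set u | `[a, b]%classic (u + c)].
  by apply/seteqP; split => u; rewrite /= !in_itv /= lerBlDr lerBrDr.
move=> [V [Vv cV]]; exists (fun s => V (s + c)); rewrite E; split.
  by move=> s sab; apply/is_velocity_shift; exact: Vv.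
move/within_continuousP : cV => cV; apply/within_continuousP => s /= sab.
have cc := @within_shift_cvg `[a, b]%classic c s.
exact: (cvg_comp _ _ cc (cV (s + c) sab)).
Qed.

End paths.

(** * Length of piecewise C1 paths *)

Section lebesgue_shift.
Context {R : realType}.
Local Notation mu := (@lebesgue_measure R).

Lemma measurable_shift (c : R) :
  measurable_fun setT (shift c : _ -> measurableTypeR R).
Proof.
apply: continuous_measurable_fun => u.
by apply: cvgD; [exact: cvg_id|exact: cvg_cst].
Qed.

Lemma lebesgue_measure_shift (c : R) (D : set (measurableTypeR R)) :
  measurable D ->
  pushforward mu (shift c : _ -> measurableTypeR R) D = mu D.
Proof.
move=> mD; apply/esym/lebesgue_measure_unique => //=.
  exact: measurable_shift.
move=> _ _ [[a b]] _ <-.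
rewrite /pushforward /=.
have -> : shift c @^-1` `]a, b]%classic = `]a - c, b - c]%classic.
  by apply/seteqP; split => u; rewrite /= !in_itv /= ltrBlDr lerBrDr.
rewrite !lebesgue_measure_itv/=.
by rewrite !lte_fin ltrD2r -!EFinD opprB addrA subrK.
Qed.

End lebesgue_shift.

Section lengths.
Context {R : realType} (M : smoothManifold R).
Local Notation A := (@matlas R M).
Local Notation mu := (@lebesgue_measure R).
Implicit Types (beta : R -> M) (a b c s : R).

(** Piecewise C1 paths, presented by appending C1 pieces one at a time.
    Continuity of the whole path, which [piecewise_C1_path] also records, is
    kept separate. *)
Inductive pw_C1 beta a : R -> Prop :=
| pw_C1_refl : pw_C1 beta a a
| pw_C1_step c b :
    pw_C1 beta a c -> c < b -> C1_path c b beta -> pw_C1 beta a b.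

Lemma pw_C1_le beta a b : pw_C1 beta a b -> a <= b.
Proof. by elim=> // c d _ ac cd _; rewrite (le_trans ac (ltW cd)). Qed.

Lemma pw_C1_cat beta a b c : pw_C1 beta a b -> pw_C1 beta b c -> pw_C1 beta a c.
Proof. by move=> ab; elim=> // d e _ ad de h; exact: pw_C1_step ad de h. Qed.

Lemma pw_C1_split beta a b c : a <= c <= b -> pw_C1 beta a b ->
  pw_C1 beta a c /\ pw_C1 beta c b.
Proof.
move=> /andP[ac cb] ab; elim: ab cb => [|d e ad IH de h].
  move=> ca; have -> : c = a by apply/eqP; rewrite eq_le ca ac.
  by split; exact: pw_C1_refl.
move=> ce; have [cd|dc] := leP c d.
  have [? cd'] := IH cd; split=> //; exact: pw_C1_step cd' de h.
split; first by apply: (pw_C1_step ad dc); exact: C1_path_sub h.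
move: ce; rewrite le_eqVlt => /orP[/eqP ->|ce]; first exact: pw_C1_refl.
apply: (pw_C1_step (pw_C1_refl _ _) ce); apply: C1_path_sub h => //; exact: ltW.
Qed.

Lemma pw_C1_ext beta beta' a b : (forall s, a <= s <= b -> beta s = beta' s) ->
  pw_C1 beta a b -> pw_C1 beta' a b.
Proof.
move=> bb' h; elim: h bb' => [|c d ac IH cd h] bb'; first exact: pw_C1_refl.
apply: (pw_C1_step _ cd).
  by apply: IH => s /andP[as_ sc]; rewrite bb'// as_ (le_trans sc (ltW cd)).
apply: C1_path_ext h => s /andP[cs sd].
by rewrite bb'// sd (le_trans (pw_C1_le ac) cs).
Qed.

Lemma pw_C1_shift beta a b c : pw_C1 beta a b ->
  pw_C1 (fun s => beta (s + c)) (a - c) (b - c).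
Proof.
elim=> [|d e _ IH de h]; first exact: pw_C1_refl.
by apply: (pw_C1_step IH); rewrite ?ltrD2r//; exact: C1_path_shift.
Qed.

Lemma piecewise_C1P beta a b : piecewise_C1_path a b beta <->
  {within `[a, b]%classic, continuous beta} /\ pw_C1 beta a b.
Proof.
split=> -[cb h]; split=> //.
  move: h => [k [p [<- <- hp]]].
  elim: k hp => [_|k IH hp]; first exact: pw_C1_refl.
  have [pk hk] := hp k (ltnSn k).
  by apply: (pw_C1_step _ pk hk); apply: IH => i ik; apply: hp; exact: ltnW.
elim: h {cb} => [|c d _ [k [p [pa pc hp]]] cd h].
  by exists 0%N, (fun=> a).
exists k.+1, (fun i => if (i <= k)%N then p i else d); split=> //.
  by rewrite ltnn.
move=> i; rewrite ltnS => ik; rewrite ik; move: ik.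
rewrite leq_eqVlt => /orP[/eqP ->|ik]; first by rewrite ltnn pc.
by rewrite ik; exact: hp.
Qed.

Section speed.
Variable F : forall x : M, tangent x -> R.
Arguments F : clear implicits.
Hypothesis hF : finsler_structure F.

(** The speed, with two-sided derivatives: it does not refer to the domain of
    the path, and agrees with the integrand of the length away from the
    endpoints. *)
Definition speed beta s : R := F (beta s) (velocity setT beta s).

(** The length of a path, as the integral of its two-sided speed. *)
Definition path_length beta a b : \bar R :=
  (\int[mu]_(s in `[a, b]%classic) (speed beta s)%:E)%E.

Lemma speed_ge0 beta s : 0 <= speed beta s.
Proof. exact: finsler_ge0. Qed.

Lemma path_length_ge0 beta a b : (0 <= path_length beta a b)%E.
Proof. by apply: integral_ge0 => s _; rewrite lee_fin speed_ge0. Qed.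

Lemma speed_C1 a b beta (V : forall s, tangent (beta s)) s : a < s < b ->
  (forall s, `[a, b]%classic s ->
     @is_velocity R M `[a, b]%classic beta s (V s)) ->
  speed beta s = F (beta s) (V s).
Proof.
move=> asb hV; rewrite /speed -(velocity_interior _ asb).
have /andP[as_ sb] := asb.
have sab : a <= s <= b by rewrite !ltW.
rewrite (velocityE (within_itv_proper (lt_trans as_ sb) sab) (hV s _))//.
Qed.

Lemma finsler_C1_continuous a b beta (V : forall s, tangent (beta s)) :
  {within `[a, b]%classic, continuous (fun s => TangentVector (V s))} ->
  {within `[a, b]%classic, continuous (fun s => F (beta s) (V s))}.
Proof.
move=> /within_continuousP cV; apply/within_continuousP => s sab.
exact: (cvg_comp (fun s => TangentVector (V s))
  (fun w : tangent_bundle M => F (tbase w) (tvec w)) (cV s sab)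
  (@finsler_continuous _ _ _ hF (TangentVector (V s)))).
Qed.

Lemma measurable_speed beta a b : pw_C1 beta a b ->
  measurable_fun `[a, b]%classic (speed beta).
Proof.
elim=> [|c d ac IH cd [V [hV cV]]].
  by rewrite set_itv1; exact: measurable_fun_set1.
have acd := pw_C1_le ac.
rewrite (itv_bndbnd_setU (x := BRight c)) ?bnd_simp ?(ltW cd)//.
apply/measurable_funU => //; split=> //.
apply/measurable_fun_itv_bndo_bndcP.
have mw : measurable_fun `[c, d]%classic (fun s => F (beta s) (V s)).
  apply: subspace_continuous_measurable_fun; first exact: measurable_itv.
  exact: finsler_C1_continuous.
apply: (@eq_measurable_fun _ _ _ _ _ (fun s => F (beta s) (V s))).
  by move=> s /set_mem; rewrite /= in_itv /= => csd; rewrite (speed_C1 csd hV).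
apply: measurable_funS mw => //.
by move=> s /=; exact: subset_itv_oo_cc.
Qed.

Lemma measurable_speed_oo beta a b : pw_C1 beta a b ->
  measurable_fun `]a, b[%classic (EFin \o speed beta).
Proof.
move=> h; apply/measurable_EFinP.
apply: measurable_funS (measurable_speed h) => //.
by move=> s /=; exact: subset_itv_oo_cc.
Qed.

Lemma finsler_lengthE beta a b : pw_C1 beta a b ->
  finsler_length F a b beta = path_length beta a b.
Proof.
move=> h; have := pw_C1_le h; rewrite le_eqVlt => /orP[/eqP ab|ab].
  by rewrite /finsler_length /path_length -ab set_itv1 !integral_set1.
have E s : `]a, b[%classic s ->
    F (beta s) (velocity `[a, b]%classic beta s) = speed beta s.
  by rewrite /= in_itv /= => asb; rewrite /speed velocity_interior.
have m := measurable_speed_oo h.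
rewrite /finsler_length /path_length.
rewrite (@integral_itv_bndoo _ _ _ _ true false); last first.
  apply: eq_measurable_fun m => s /set_mem sab; by rewrite /= E.
rewrite [RHS](@integral_itv_bndoo _ _ _ _ true false)//.
by apply: eq_integral => s /set_mem sab; rewrite E.
Qed.

Lemma path_length_cat beta a b c : a <= c <= b -> pw_C1 beta a b ->
  path_length beta a b = (path_length beta a c + path_length beta c b)%E.
Proof.
move=> /andP[ac cb] h.
have m : measurable_fun `[a, b]%classic (EFin \o speed beta).
  by apply/measurable_EFinP; exact: measurable_speed.
have E : `[a, b]%classic = `[a, c]%classic `|` `]c, b]%classic.
  by rewrite (itv_bndbnd_setU (x := BRight c))// ?bnd_simp.
rewrite /path_length E ge0_integral_setU//=; first last.
- apply/disj_setPS => s /= []; rewrite !in_itv /= => /andP[_ sc] /andP[cs _].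
  by move: cs; rewrite ltNge sc.
- by move=> s _; rewrite lee_fin speed_ge0.
- by rewrite -E.
congr (_ + _)%E; apply: integral_itv_obnd_cbnd.
by apply: measurable_funS m => //; rewrite E; exact: subsetUr.
Qed.

Lemma path_length_shift beta a b c : pw_C1 beta a b ->
  path_length (fun s => beta (s + c)) (a - c) (b - c) = path_length beta a b.
Proof.
move=> h.
have m : measurable_fun `[a, b]%classic (EFin \o speed beta).
  by apply/measurable_EFinP; exact: measurable_speed.
have E : `[a - c, b - c]%classic = shift c @^-1` `[a, b]%classic.
  by apply/seteqP; split => u; rewrite /= !in_itv /= lerBlDr lerBrDr.
rewrite /path_length E.
transitivity (\int[mu]_(s in shift c @^-1` `[a, b]%classic)
    ((EFin \o speed beta) \o (shift c : _ -> measurableTypeR R)) s)%E.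
  by apply: eq_integral => s _ /=; rewrite /speed velocity_shift.
have ge0 : {in `[a, b]%classic, forall s, (0 <= (speed beta s)%:E)%E}.
  by move=> s _; rewrite lee_fin speed_ge0.
have := @ge0_integral_pushforward _ _ (measurableTypeR R) (measurableTypeR R) R
  (shift c) (measurable_shift c) mu _ _ (measurable_itv `[a, b]) m ge0.
move=> <-.
apply: eq_measure_integral; first exact: measurable_shift.
by move=> mc D mD _; exact: lebesgue_measure_shift.
Qed.

End speed.
End lengths.

(** * The Finsler distance *)

Section distance.
Context {R : realType} (M : smoothManifold R).
Local Notation A := (@matlas R M).
Variable F : forall x : M, tangent x -> R.
Arguments F : clear implicits.
Hypothesis hF : finsler_structure F.
Implicit Types (beta : R -> M) (a b c s : R).

Lemma speed_near_eq beta beta' s : (\forall u \near s, beta u = beta' u) ->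
  speed F beta s = speed F beta' s.
Proof.
(* [velocity] at [s] has a type depending on the path, so the base point is
   abstracted before it is rewritten. *)
move=> bb'; pose sp x (f : R -> M) := F x (xget 0 [set v : tangent x |
  forall i, cdom (A i) x ->
  (fun u => (u - s)^-1 *: (cmap (A i) (f u) - cmap (A i) x))
      @ within setT (s^') --> tcoord v i]).
rewrite -[LHS]/(sp (beta s) beta) -[RHS]/(sp (beta' s) beta').
rewrite (nbhs_singleton bb') /sp; congr (F _ (xget _ _)).
have bb'' : s^' (fun u => beta u = beta' u).
  by rewrite /dnbhs /within /=; apply: filterS bb'.
have E i x : (fun u => (u - s)^-1 *: (cmap (A i) (beta u) - cmap (A i) x))
      @ within setT (s^') =
    (fun u => (u - s)^-1 *: (cmap (A i) (beta' u) - cmap (A i) x))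
      @ within setT (s^').
  rewrite withinET; apply/seteqP; split => D; rewrite /fmap /= => H.
    by apply: filterS2 H bb'' => u /= + uE; rewrite uE.
  by apply: filterS2 H bb'' => u /= + uE; rewrite uE.
by apply/seteqP; split => v /= vv i si; [rewrite -E|rewrite E]; exact: vv.
Qed.

Lemma path_length_ext beta beta' a b : pw_C1 beta a b ->
  (forall s, a <= s <= b -> beta s = beta' s) ->
  path_length F beta a b = path_length F beta' a b.
Proof.
move=> h bb'; have h' := pw_C1_ext bb' h.
rewrite /path_length (@integral_itv_bndoo _ _ _ _ true false); last first.
  exact: measurable_speed_oo.
rewrite [RHS](@integral_itv_bndoo _ _ _ _ true false); last first.
  exact: measurable_speed_oo.
apply: eq_integral => s /set_mem /= sab; congr (_%:E); apply: speed_near_eq.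
apply: filterS (near_in_itvoo sab) => u /=.
by rewrite in_itv /= => /andP[au ub]; apply: bb'; rewrite !ltW.
Qed.

Lemma finsler_dist_le_path beta a b :
  {within `[a, b]%classic, continuous beta} -> pw_C1 beta a b ->
  (finsler_dist F (beta a) (beta b) <= path_length F beta a b)%E.
Proof.
move=> cb h; apply: ereal_inf_lbound; exists a, b, beta; split=> //.
- exact: pw_C1_le h.
- exact/piecewise_C1P.
- by rewrite finsler_lengthE.
Qed.

Lemma finsler_dist_lb x y l :
  (forall beta a b, {within `[a, b]%classic, continuous beta} ->
     pw_C1 beta a b -> beta a = x -> beta b = y ->
     (l <= path_length F beta a b)%E) ->
  (l <= finsler_dist F x y)%E.
Proof.
move=> hl; apply: le_ereal_inf_tmp => _ [a [b [beta [_ hb bx by_ ->]]]].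
have /piecewise_C1P[cb h] := hb.
by rewrite finsler_lengthE//; exact: hl.
Qed.

Lemma finsler_dist_ge0 x y : (0 <= finsler_dist F x y)%E.
Proof. by apply: finsler_dist_lb => *; exact: path_length_ge0. Qed.

Lemma finsler_dist_refl x : finsler_dist F x x = 0%E.
Proof.
apply/eqP; rewrite eq_le finsler_dist_ge0 andbT.
have := @finsler_dist_le_path (fun=> x) 0 0.
rewrite /path_length set_itv1 integral_set1; apply; last exact: pw_C1_refl.
by apply: continuous_subspaceT => u; exact: cvg_cst.
Qed.

(** The second path is reparametrised by a translation, so that it starts when
    the first one ends. *)
Lemma finsler_dist_concat beta beta' a b c e :
  {within `[a, b]%classic, continuous beta} -> pw_C1 beta a b ->
  {within `[c, e]%classic, continuous beta'} -> pw_C1 beta' c e ->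
  beta b = beta' c ->
  (finsler_dist F (beta a) (beta' e) <=
   path_length F beta a b + path_length F beta' c e)%E.
Proof.
move=> cb hb cb' hb' bc.
pose d := c - b.
pose g s := if s <= b then beta s else beta' (s + d).
have gl s : a <= s <= b -> beta s = g s by rewrite /g => /andP[_ ->].
have cd : c - d = b by rewrite /d opprB addrC subrK.
have gr s : c - d <= s <= e - d -> beta' (s + d) = g s.
  rewrite cd /g => /andP[bs _]; case: ifPn => // sb.
  have -> : s = b by apply/eqP; rewrite eq_le sb bs.
  by rewrite bc /d addrC subrK.
have hl := pw_C1_ext gl hb.
have hr := pw_C1_ext gr (pw_C1_shift d hb').
have ab := pw_C1_le hb.
have be : b <= e - d by rewrite -cd lerD2r; exact: pw_C1_le hb'.
have h : pw_C1 g a (e - d) by apply: (pw_C1_cat hl); rewrite -{1}cd.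
have abe : a <= b <= e - d by rewrite ab be.
have <- : path_length F g a (e - d) =
    (path_length F beta a b + path_length F beta' c e)%E.
  rewrite (path_length_cat hF abe h) -(path_length_ext hb gl) -{2}cd.
  by rewrite -(path_length_ext (pw_C1_shift d hb') gr) path_length_shift.
have ga : g a = beta a by rewrite -gl// lexx.
have ge : g (e - d) = beta' e by rewrite -gr ?subrK// cd be lexx.
rewrite -ga -ge; apply: finsler_dist_le_path => //.
have -> : `[a, e - d]%classic = `[a, b]%classic `|` `[b, e - d]%classic.
  apply/seteqP; split => s; rewrite /= !in_itv /=.
    move=> /andP[as_ se]; have [sb|/ltW bs] := leP s b; [left|right].
      by rewrite as_.
    by rewrite bs.
  move=> [] /andP[]; first by move=> -> /le_trans ->.
  by move=> /(le_trans ab) -> ->.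
apply: withinU_continuous.
- exact: itv_closed.
- exact: itv_closed.
- apply: subspace_eq_continuous cb => s /set_mem; rewrite /= in_itv; exact: gl.
apply: (@subspace_eq_continuous _ _ _ (fun s => beta' (s + d))).
  by move=> s /set_mem; rewrite /= in_itv /= -{1}cd; exact: gr.
move/within_continuousP : cb' => cb'; apply/within_continuousP => s sab.
have ed : `[b, e - d]%classic = [set u | `[c, e]%classic (u + d)].
  by apply/seteqP; split => u; rewrite /= !in_itv /= -{1}cd lerBlDr lerBrDr.
rewrite ed in sab *.
have cc : u + d @[u --> within [set u | `[c, e]%classic (u + d)] (nbhs s)] -->
    within `[c, e]%classic (nbhs (s + d)).
  exact: within_shift_cvg.
exact: (cvg_comp (shift d) beta' cc (cb' (s + d) sab)).
Qed.

Lemma finsler_dist_triangle x y z :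
  (finsler_dist F x z <= finsler_dist F x y + finsler_dist F y z)%E.
Proof.
have pinfty_or_fin (l : \bar R) : (0 <= l)%E -> l = +oo%E \/ l \is a fin_num.
  by case: l => [r|_|] //; [right|left].
have [->|fxy] := pinfty_or_fin _ (finsler_dist_ge0 x y).
  rewrite addye ?leey//.
  by rewrite gt_eqF// (lt_le_trans _ (finsler_dist_ge0 y z))// ltNy0.
rewrite -leeBlDl//; apply: finsler_dist_lb => beta' c e cb' hb' by_ bz.
rewrite leeBlDl//.
have [->|fl] := pinfty_or_fin _ (path_length_ge0 hF beta' c e).
  by rewrite addey ?leey// -(fineK fxy).
rewrite -leeBlDr//; apply: finsler_dist_lb => beta a b cb hb bx by2.
rewrite leeBlDr// -bx -bz; apply: finsler_dist_concat => //.
by rewrite by2 by_.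
Qed.

End distance.

(** * Lengths in a chart *)

Section chart_estimates.
Context {R : realType} (M : smoothManifold R).
Local Notation A := (@matlas R M).
Local Notation rV := 'rV[R]_(mdim M).
Variable F : forall x : M, tangent x -> R.
Arguments F : clear implicits.
Hypothesis hF : finsler_structure F.
Implicit Types (beta : R -> M) (a b c s : R).

Lemma path_length_le beta a b C : pw_C1 beta a b ->
  (forall s, a < s < b -> speed F beta s <= C) ->
  (path_length F beta a b <= (C * (b - a))%:E)%E.
Proof.
move=> h hC; have := pw_C1_le h; rewrite le_eqVlt => /orP[/eqP <-|ab].
  by rewrite /path_length set_itv1 integral_set1 subrr mulr0.
have C0 : 0 <= C.
  apply: le_trans (hC ((a + b) / 2) _); first exact: speed_ge0.
  by rewrite !midf_lt.
have m := measurable_speed_oo hF h.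
rewrite /path_length (@integral_itv_bndoo _ _ _ _ true false)//.
apply: (@le_trans _ _ (\int[lebesgue_measure]_(s in `]a, b[%classic) C%:E)%E).
  apply: ge0_le_integral => //.
  by move=> s _; rewrite lee_fin speed_ge0.
rewrite integral_cst//= lebesgue_measure_itv /= lte_fin ab.
by rewrite -EFinD -EFinM.
Qed.

Lemma path_length_ge beta a b C : pw_C1 beta a b ->
  (forall s, a < s < b -> C <= speed F beta s) ->
  ((C * (b - a))%:E <= path_length F beta a b)%E.
Proof.
move=> h hC; have := pw_C1_le h; rewrite le_eqVlt => /orP[/eqP <-|ab].
  by rewrite subrr mulr0 path_length_ge0.
have [C0|/ltW C0] := leP 0 C; last first.
  apply: le_trans (path_length_ge0 hF _ _ _).
  by rewrite lee_fin mulr_le0_ge0// subr_ge0 ltW.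
have m := measurable_speed_oo hF h.
rewrite /path_length (@integral_itv_bndoo _ _ _ _ true false)//.
apply: (@le_trans _ _ (\int[lebesgue_measure]_(s in `]a, b[%classic) C%:E)%E).
  rewrite integral_cst//= lebesgue_measure_itv /= lte_fin ab.
  by rewrite -EFinD -EFinM.
exact: ge0_le_integral.
Qed.

(** Coordinate segments, as paths in the manifold. *)
Section segment.
Variables (i : mindex M) (u w : rV).
Let seg s := u + s *: w.
Hypothesis hseg : forall s, 0 <= s <= 1 -> ccod (A i) (seg s).

Let beta s := cinv (A i) (seg s).
Let V s : tangent (beta s) := coord_vector i (beta s) w.

Let segE s s' : seg s' = (s' - s) *: w + seg s.
Proof. by rewrite /seg addrCA -scalerDl subrK. Qed.

Let segc : continuous seg.
Proof.
move=> s; apply: cvgD; first exact: cvg_cst.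
by apply: cvgZ; [exact: cvg_id|exact: cvg_cst].
Qed.

(** In a chart [j] the segment is its image under the transition map, so its
    velocity is a directional derivative of that map. *)
Lemma segment_velocity s : 0 <= s <= 1 ->
  @is_velocity R M `[0, 1]%classic beta s (V s).
Proof.
move=> s01 j sj.
have si := hseg s01.
have [d _] := @mcompat _ M i j 1%N.
have ds : differentiable (transition i j) (seg s) by apply: d.
have xi := cinv_cdom si.
have -> : tcoord (coord_vector i (cinv (A i) (seg s)) w) j =
    'D_w (transition i j) (seg s).
  apply: (etrans (tcoord_trans _ xi sj)).
  by rewrite (coord_vectorE w xi) (cinvK si) deriveE.
have q : h^-1 *: ((transition i j \o shift (seg s)) (h *: w) -
    transition i j (seg s)) @[h --> 0^'] --> 'D_w (transition i j) (seg s).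
  exact: diff_derivable.
have sh : s' - s @[s' --> s^'] --> 0^'.
  by have := @within_shift R setT (- s) s; rewrite subrr !withinET => ->.
have := cvg_comp _ _ sh q.
have -> : (fun h => h^-1 *: ((transition i j \o shift (seg s)) (h *: w) -
    transition i j (seg s))) \o (fun s' => s' - s) =
  (fun s' => (s' - s)^-1 *: (cmap (A j) (cinv (A i) (seg s')) -
                             cmap (A j) (cinv (A i) (seg s)))).
  by apply/funext => s' /=; rewrite -segE.
exact: cvg_within_filter.
Qed.

Lemma segment_C1 : C1_path 0 1 beta.
Proof.
exists V; split.
  by move=> s; rewrite /= in_itv /=; exact: segment_velocity.
apply/within_continuousP => s; rewrite /= in_itv /= => s01.
have c : (seg s', w) @[s' --> s] --> (seg s, w).
  exact: (cvg_pair (@segc s) (cvg_cst w)).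
have := cvg_comp _ _ c (@frame_cvg R M i (seg s) w (hseg s01)).
exact: cvg_within_filter.
Qed.

Lemma finsler_dist_segment C :
  (forall s, 0 <= s <= 1 ->
     F (cinv (A i) (seg s)) (coord_vector i (cinv (A i) (seg s)) w) <= C) ->
  (finsler_dist F (cinv (A i) u) (cinv (A i) (u + w)) <= C%:E)%E.
Proof.
move=> hC.
have hb : pw_C1 beta 0 1 := pw_C1_step (pw_C1_refl _ _) ltr01 segment_C1.
have b0 : beta 0 = cinv (A i) u by rewrite /beta /seg scale0r addr0.
have b1 : beta 1 = cinv (A i) (u + w) by rewrite /beta /seg scale1r.
rewrite -b0 -b1.
have cb : {within `[0, 1]%classic, continuous beta}.
  apply/within_continuousP => s; rewrite /= in_itv /= => s01.
  have H : beta s' @[s' --> s] --> beta s.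
    exact: (cvg_comp _ _ (@segc s) (@cinv_cvg R M i (seg s) (hseg s01))).
  exact: cvg_within_filter H.
apply: le_trans (finsler_dist_le_path hF cb hb) _.
have -> : C%:E = (C * (1 - 0))%:E by rewrite subr0 mulr1.
apply: path_length_le => // s s01.
have s01' : 0 <= s <= 1 by have /andP[? ?] := s01; rewrite !ltW.
rewrite (@speed_C1 R M F 0 1 beta V s s01); first exact: hC.
by move=> s'; rewrite /= in_itv /=; exact: segment_velocity.
Qed.
End segment.

(** A path inside a chart is at least as long as its chord, measured with any
    weak norm [N] that [F] dominates along the path. *)
Section chord.
Variables (i : mindex M) (N : rV -> R).
Hypothesis N_cont : continuous N.
Hypothesis N_subadd : forall v w, N (v + w) <= N v + N w.
Hypothesis N_hom : forall (l : R) v, 0 <= l -> N (l *: v) = l * N v.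

Let N0 : N 0 = 0.
Proof. by rewrite -(scale0r 0) N_hom// mul0r. Qed.

(** Near each parameter the difference quotients are close to the velocity,
    whose norm is at most the speed; so the inequality holds on short intervals
    at that parameter up to [e] times their length, and propagates along
    [c, d]. *)
Lemma chord_le_C1 beta c d : c < d -> C1_path c d beta ->
  (forall s, c <= s <= d -> cdom (A i) (beta s) /\
     forall v : tangent (beta s), N (tcoord v i) <= F (beta s) v) ->
  ((N (cmap (A i) (beta d) - cmap (A i) (beta c)))%:E <=
   path_length F beta c d)%E.
Proof.
move=> cd hC1 hN; have [V [hV cV]] := hC1.
have /within_continuousP cw := finsler_C1_continuous hF cV.
pose u s := cmap (A i) (beta s).
have hpw s1 s2 : c <= s1 -> s1 <= s2 -> s2 <= d -> pw_C1 beta s1 s2.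
  move=> cs1; rewrite le_eqVlt => /orP[/eqP <-|s12] s2d.
    exact: pw_C1_refl.
  by apply: (pw_C1_step (pw_C1_refl _ _) s12); exact: C1_path_sub hC1.
suff key e : 0 < e ->
    ((N (u d - u c))%:E <= path_length F beta c d + (e * (d - c))%:E)%E.
  apply/lee_addgt0Pr => e e0.
  have dc : 0 < d - c by rewrite subr_gt0.
  have := key (e / (d - c)) (divr_gt0 e0 dc).
  by rewrite divfK// gt_eqF.
move=> e0.
pose P s := ((N (u s - u c))%:E <= path_length F beta c s + (e * (s - c))%:E)%E.
apply: (@real_induction R P c d (ltW cd)).
  by rewrite /P !subrr N0 mulr0 adde0 path_length_ge0.
move=> s0 s0cd.
have s0cd' : `[c, d]%classic s0 by rewrite /= in_itv.
have [s0i s0N] := hN s0 s0cd.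
pose q s := (s - s0)^-1 *: (u s - u s0).
have H1 : \forall s \near within `[c, d]%classic (s0^'),
    N (q s) < N (tcoord (V s0) i) + e / 2.
  have Nq : N (q s) @[s --> within `[c, d]%classic (s0^')] -->
      N (tcoord (V s0) i).
    exact: (cvg_comp _ _ (hV s0 s0cd' i s0i) (@N_cont (tcoord (V s0) i))).
  have PF := within_itv_proper cd s0cd.
  by apply: (cvgr_lt _ Nq); rewrite ltrDl divr_gt0.
have H2 : \forall s \near within `[c, d]%classic (nbhs s0),
    F (beta s0) (V s0) - e / 2 < F (beta s) (V s).
  by apply: (cvgr_gt _ (cw s0 s0cd')); rewrite ltrBlDr ltrDl divr_gt0.
have H : nbhs s0 [set s | (s != s0 -> `[c, d]%classic s ->
      N (q s) < N (tcoord (V s0) i) + e / 2) /\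
    (`[c, d]%classic s -> F (beta s0) (V s0) - e / 2 < F (beta s) (V s))].
  have H1' : nbhs s0 [set s | s != s0 -> `[c, d]%classic s ->
    N (q s) < N (tcoord (V s0) i) + e / 2] := H1.
  have H2' : nbhs s0 [set s | `[c, d]%classic s ->
    F (beta s0) (V s0) - e / 2 < F (beta s) (V s)] := H2.
  by apply: filterS2 H1' H2' => s; split.
have [r /= r0 hr] := (nbhs_ballP _ _).1 H.
have step s1 s2 : c <= s1 -> s1 < s2 -> s2 <= d -> s2 - s1 < r ->
    s1 = s0 \/ s2 = s0 ->
    ((N (u s2 - u s1))%:E <= path_length F beta s1 s2 + (e * (s2 - s1))%:E)%E.
  move=> cs1 s12 s2d s12r s120.
  have s210 : 0 < s2 - s1 by rewrite subr_gt0.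
  have hball s : s1 <= s <= s2 -> ball s0 r s.
    by move=> /andP[? ?]; rewrite /ball /= ltr_norml; case: s120 => ?; lra.
  have hcd s : s1 <= s <= s2 -> `[c, d]%classic s.
    by move=> /andP[? ?]; rewrite /= in_itv /=; lra.
  have Nle : N (u s2 - u s1) <= (N (tcoord (V s0) i) + e / 2) * (s2 - s1).
    (* the endpoint other than [s0], where the quotient is evaluated *)
    pose s := if s0 == s1 then s2 else s1.
    have ss : s1 <= s <= s2 by rewrite /s; case: ifP; rewrite lexx ltW.
    have sn : s != s0.
      rewrite /s; case: ifPn => [/eqP ->|]; first by rewrite gt_eqF.
      by rewrite eq_sym.
    have -> : u s2 - u s1 = (s2 - s1) *: q s.
      rewrite /q /s; case: ifPn => [/eqP ->|s01].
        by rewrite scalerA divff ?scale1r// gt_eqF.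
      case: s120 => [s1s0|<-]; first by rewrite s1s0 eqxx in s01.
      rewrite scalerA -(opprB s2 s1) invrN mulrN divff ?gt_eqF//.
      by rewrite scaleN1r opprB.
    rewrite N_hom ?(ltW s210)// mulrC ler_pM2r//.
    exact/ltW/(hr s (hball s ss)).1/hcd.
  have Lge : (((F (beta s0) (V s0) - e / 2) * (s2 - s1))%:E <=
      path_length F beta s1 s2)%E.
    apply: path_length_ge; first exact: hpw cs1 (ltW s12) s2d.
    move=> s /andP[s1s ss2].
    rewrite (@speed_C1 R M F c d beta V s _ hV); last by lra.
    apply/ltW; apply: (hr s _).2; first by apply: hball; rewrite !ltW.
    by apply: hcd; rewrite !ltW.
  apply: (@le_trans _ _ (((F (beta s0) (V s0) - e / 2) * (s2 - s1))%:E +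
     (e * (s2 - s1))%:E)%E); last by rewrite leeD2r.
  rewrite -EFinD lee_fin (le_trans Nle)// -mulrDl ler_pM2r//.
  by have := s0N (V s0); lra.
have trans s1 s2 : c <= s1 -> s1 < s2 -> s2 <= d -> s2 - s1 < r ->
    s1 = s0 \/ s2 = s0 -> P s1 -> P s2.
  move=> cs1 s12 s2d s12r s120 Ps1; rewrite /P.
  have s1cs2 : c <= s1 <= s2 by rewrite cs1 ltW.
  rewrite (path_length_cat hF s1cs2); last first.
    by apply: hpw => //; apply: le_trans cs1 (ltW s12).
  have -> : e * (s2 - c) = e * (s1 - c) + e * (s2 - s1) by ring.
  rewrite EFinD addeACA.
  apply: le_trans (leeD Ps1 (step _ _ cs1 s12 s2d s12r s120)).
  rewrite -EFinD lee_fin.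
  have -> : u s2 - u c = (u s1 - u c) + (u s2 - u s1).
    by rewrite [RHS]addrC [RHS]addrA subrK.
  exact: N_subadd.
have /andP[cs0 s0d] := s0cd.
exists r => // s /andP[cs sd]; rewrite ltr_norml => /andP[ss0 s0s]; split.
  rewrite le_eqVlt => /orP[/eqP -> //|ss].
  by apply: (trans s s0) => //; [lra|right].
rewrite le_eqVlt => /orP[/eqP -> //|ss].
by apply: (trans s0 s) => //; left.
Qed.

Lemma chord_le beta a b : pw_C1 beta a b ->
  (forall s, a <= s <= b -> cdom (A i) (beta s) /\
     forall v : tangent (beta s), N (tcoord v i) <= F (beta s) v) ->
  ((N (cmap (A i) (beta b) - cmap (A i) (beta a)))%:E <=
   path_length F beta a b)%E.
Proof.
elim=> [|c d ac IH cd h] hN.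
  by rewrite subrr N0 path_length_ge0.
have acd : a <= c <= d by rewrite (pw_C1_le ac) ltW.
rewrite (path_length_cat hF acd (pw_C1_step ac cd h)).
have hac : forall s, a <= s <= c -> cdom (A i) (beta s) /\
    forall v : tangent (beta s), N (tcoord v i) <= F (beta s) v.
  by move=> s /andP[as_ sc]; apply: hN; rewrite as_ (le_trans sc (ltW cd)).
have hcd : forall s, c <= s <= d -> cdom (A i) (beta s) /\
    forall v : tangent (beta s), N (tcoord v i) <= F (beta s) v.
  by move=> s /andP[cs sd]; apply: hN; rewrite sd (le_trans (pw_C1_le ac) cs).
apply: le_trans (leeD (IH hac) (chord_le_C1 cd h hcd)).
rewrite -EFinD lee_fin.
apply: le_trans (N_subadd _ _).
by rewrite [X in _ <= N X]addrC [X in _ <= N X]addrA subrK.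
Qed.

End chord.
End chart_estimates.

(** * The norm in a chart and its local variation *)

Section sphere.
Context {R : realType} (n : nat).
Local Notation rV := 'rV[R]_n.
Variable N : rV -> R.
Hypothesis N_cont : continuous N.
Hypothesis N_hom : forall (l : R) v, 0 <= l -> N (l *: v) = l * N v.

Let N0 : N 0 = 0.
Proof. by rewrite -(scale0r 0) N_hom// mul0r. Qed.

Lemma compact_sphere : compact [set v : rV | `|v| = 1].
Proof.
apply: bounded_closed_compact.
  by exists 1; split=> // r r1 v /= ->; exact: ltW.
have -> : [set v : rV | `|v| = 1] = Num.norm @^-1` [set 1] by [].
by apply: closed_comp => [v _|]; [exact: norm_continuous|exact: closed_eq].
Qed.

Lemma normalize (v : rV) : v != 0 -> `| `|v|^-1 *: v | = 1.
Proof.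
by move=> v0; rewrite normrZ normfV normr_id mulVf// normr_eq0.
Qed.

Lemma norm_lower_bound : (forall v, v != 0 -> 0 < N v) ->
  exists2 m, 0 < m & forall v, m * `|v| <= N v.
Proof.
move=> Npos.
have /compact_near_coveringP cov := compact_sphere.
have : \forall m \near (0 : R)^'+,
    [set v : rV | `|v| = 1] `<=` [set v | m < N v].
  apply: (cov _ _ (fun m v => m < N v)) => v /= v1.
  have v0 : v != 0 by rewrite -normr_eq0 v1 oner_eq0.
  exists ([set w | N v / 2 < N w], [set m | m < N v / 2]) => /=.
    split; first by apply: (cvgr_gt _ (@N_cont v)); have := Npos v v0; lra.
    by apply: nbhs_right_lt; rewrite divr_gt0// Npos.
  by move=> [w m] /= [? ?]; lra.
move=> H; have H0 : \forall m \near (0 : R)^'+, 0 < m by exact: nbhs_right_gt.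
have [m [m0 hm]] := filter_ex (filterI H0 H).
exists m => // v; have [->|v0] := eqVneq v 0.
  by rewrite normr0 mulr0 N0.
have := hm _ (normalize v0); rewrite /= N_hom ?invr_ge0// => h.
by rewrite -ler_pdivlMr ?normr_gt0// mulrC ltW.
Qed.

Lemma norm_upper_bound : exists2 K, 0 < K & forall v, N v <= K * `|v|.
Proof.
have /compact_near_coveringP cov := compact_sphere.
have : \forall K \near +oo, [set v : rV | `|v| = 1] `<=` [set v | N v < K].
  apply: (cov _ _ (fun K v => N v < K)) => v /= v1.
  exists ([set w | N w < N v + 1], [set K | N v + 1 < K]) => /=.
    split; first by apply: (cvgr_lt _ (@N_cont v)); lra.
    by apply: nbhs_pinfty_gt; exact: num_real.
  by move=> [w K] /= [? ?]; lra.
move=> H; have H0 : \forall K \near +oo, (0 : R) < K.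
  by apply: nbhs_pinfty_gt; exact: num_real.
have [K [K0 hK]] := filter_ex (filterI H0 H).
exists K => // v; have [->|v0] := eqVneq v 0.
  by rewrite normr0 mulr0 N0.
have := hK _ (normalize v0); rewrite /= N_hom ?invr_ge0// => h.
by rewrite -ler_pdivrMr ?normr_gt0// mulrC ltW.
Qed.

End sphere.

Section chart_norm.
Context {R : realType} (M : smoothManifold R).
Local Notation A := (@matlas R M).
Local Notation rV := 'rV[R]_(mdim M).
Variable F : forall x : M, tangent x -> R.
Arguments F : clear implicits.
Hypothesis hF : finsler_structure F.

(** The weak norm of the tangent space at [x], in the coordinates of the chart
    [i]; meaningful when [x] lies in the domain of the chart. *)
Definition chart_norm (i : mindex M) (x : M) (v : rV) : R :=
  F x (coord_vector i x v).

Variables (i : mindex M) (p : M).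
Hypothesis pi : cdom (A i) p.

Lemma chart_normE x (v : tangent x) : cdom (A i) x ->
  chart_norm i x (tcoord v i) = F x v.
Proof. by move=> xi; rewrite /chart_norm tcoordK. Qed.

Lemma chart_norm_subadd x v w : cdom (A i) x ->
  chart_norm i x (v + w) <= chart_norm i x v + chart_norm i x w.
Proof.
by move=> xi; rewrite /chart_norm coord_vectorD//; exact: finsler_subadditive.
Qed.

Lemma chart_norm_hom x (l : R) v : cdom (A i) x -> 0 <= l ->
  chart_norm i x (l *: v) = l * chart_norm i x v.
Proof.
move=> xi l0; rewrite /chart_norm coord_vectorZ//.
exact: finsler_homogeneous.
Qed.

Lemma chart_norm0 x : cdom (A i) x -> chart_norm i x 0 = 0.
Proof. by move=> xi; rewrite -(scale0r 0) chart_norm_hom// mul0r. Qed.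

Lemma chart_norm_ge0 x v : 0 <= chart_norm i x v.
Proof. exact: finsler_ge0. Qed.

Lemma chart_norm_gt0 x v : cdom (A i) x -> v != 0 -> 0 < chart_norm i x v.
Proof.
move=> xi v0; rewrite lt_neqAle chart_norm_ge0 andbT eq_sym.
by apply: contra v0 => /eqP/(finsler_eq0 hF)/coord_vector_eq0 ->.
Qed.

Lemma chart_norm_cvg u v : ccod (A i) u ->
  {for (u, v), continuous
     (fun z : rV * rV => chart_norm i (cinv (A i) z.1) z.2)}.
Proof.
move=> ui.
pose w := TangentVector (coord_vector i (cinv (A i) u) v).
exact: (cvg_comp _ _ (@frame_cvg R M i u v ui)
  (@finsler_continuous _ _ _ hF w)).
Qed.

Lemma chart_norm_continuous : continuous (chart_norm i p).
Proof.
move=> v; have c : (cmap (A i) p, w) @[w --> v] --> (cmap (A i) p, v).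
  exact: (cvg_pair (cvg_cst (cmap (A i) p)) (@cvg_id _ (nbhs v))).
have := cvg_comp _ _ c (@chart_norm_cvg _ v (cmap_ccod pi)).
by rewrite /comp /= cmapK.
Qed.

(** Near a point, the weak norms of the tangent spaces are close to each other,
    uniformly in the vector. It is enough to compare them on the unit
    sphere, which is compact. *)
Lemma chart_norm_near e : 0 < e ->
  \forall u \near cmap (A i) p, forall v,
    `|chart_norm i (cinv (A i) u) v - chart_norm i p v| <= e * chart_norm i p v.
Proof.
move=> e0; set u0 := cmap (A i) p.
have [m m0 hm] := norm_lower_bound chart_norm_continuous
  (fun l v => chart_norm_hom v pi) (fun v => chart_norm_gt0 pi).
have /compact_near_coveringP cov := @compact_sphere R (mdim M).
have H : \forall u \near u0, [set v : rV | `|v| = 1] `<=`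
    [set v | `|chart_norm i (cinv (A i) u) v - chart_norm i p v| < e * m].
  apply: (cov rV (nbhs u0) (fun u v =>
    `|chart_norm i (cinv (A i) u) v - chart_norm i p v| < e * m)
    (nbhs_filter u0)) => v /= v1.
  have sw : (z.2, z.1) @[z --> (v, u0)] --> (u0, v).
    exact: (cvg_pair (@cvg_snd _ _ _ _ _) (@cvg_fst _ _ _ _ _)).
  have c1 := cvg_comp _ _ sw (@chart_norm_cvg u0 v (cmap_ccod pi)).
  have c2 : chart_norm i p z.1 @[z --> (v, u0)] --> chart_norm i p v.
    apply: (cvg_comp (@fst rV rV) (chart_norm i p) _
      (@chart_norm_continuous v)).
    exact: cvg_fst.
  have := cvgB c1 c2; rewrite /= cmapK// subrr => /(_ (nbhs_filter _)) c.
  exact: (cvgr0_norm_lt _ c _ (mulr_gt0 e0 m0)).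
have C : \forall u \near u0, ccod (A i) u by exact/ccod_nbhs/cmap_ccod.
apply: filterS2 H C => u hu ui v; have xi := cinv_cdom ui.
have [->|v0] := eqVneq v 0; first by rewrite !chart_norm0// subrr normr0 mulr0.
have := hu _ (normalize v0); rewrite /= !chart_norm_hom ?invr_ge0//.
rewrite -mulrBr normrM normfV normr_id mulrC ltr_pdivrMr ?normr_gt0// => /ltW h.
by apply: le_trans h _; rewrite -mulrA ler_pM2l.
Qed.

End chart_norm.

(** * Local comparison of the distance with the norm in a chart *)

Section chart_balls.
Context {R : realType} (M : smoothManifold R).
Local Notation A := (@matlas R M).
Local Notation rV := 'rV[R]_(mdim M).
Variables (i : mindex M) (u0 : rV) (r : R).
Implicit Types (beta : R -> M) (a b s : R).

(** Open and closed coordinate balls, as subsets of the manifold. *)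
Definition chart_ball : set M :=
  [set x | cdom (A i) x /\ `|cmap (A i) x - u0| < r].

Definition chart_cball : set M :=
  [set x | cdom (A i) x /\ `|cmap (A i) x - u0| <= r].

Lemma chart_ballW x : chart_ball x -> chart_cball x.
Proof. by move=> [xi /ltW]. Qed.

Lemma chart_ball_open : open chart_ball.
Proof.
rewrite openE => x [xi xr]; apply: filterI; first exact: cdom_nbhs.
have c : `|cmap (A i) y - u0| @[y --> x] --> `|cmap (A i) x - u0|.
  by apply: cvg_norm; apply: cvgB; [exact: cmap_cvg|exact: cvg_cst].
exact: (cvgr_lt _ c).
Qed.

Hypothesis hr : forall u, `|u - u0| <= r -> ccod (A i) u.

(** A closed coordinate ball is compact, hence closed in the Hausdorff
    manifold. *)
Lemma chart_cball_closed : closed chart_cball.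
Proof.
apply: compact_closed; first exact: mhausdorff.
have -> : chart_cball = cinv (A i) @` [set u | `|u - u0| <= r].
  apply/seteqP; split => [x [xi xr]|_ [u ur <-]].
    by exists (cmap (A i) x) => //; rewrite cmapK.
  by split; [exact/cinv_cdom/hr|rewrite cinvK//; exact: hr].
apply: continuous_compact.
  apply: continuous_subspaceW (@cinv_continuous _ _ _ (A i)).
  by move=> u /hr.
apply: bounded_closed_compact.
  exists (`|u0| + r); split; first exact: num_real.
  move=> s us u /= ur; apply/ltW; apply: le_lt_trans us.
  by rewrite -(subrK u0 u) (le_trans (ler_normD _ _))// addrC lerD2l.
have -> : [set u : rV | `|u - u0| <= r] =
    (fun u => `|u - u0|) @^-1` [set s | s <= r] by [].
apply: closed_comp; last exact: closed_le.
move=> u _.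
apply: (cvg_comp (fun u => u - u0) Num.norm _ (@norm_continuous _ _ _)).
exact: (cvgB (@cvg_id _ (nbhs u)) (cvg_cst u0)).
Qed.

(** A path starting inside the ball either stays inside, or reaches the
    boundary sphere without leaving the closed ball before. *)
Lemma chart_ball_exit beta a b : {within `[a, b]%classic, continuous beta} ->
  chart_ball (beta a) ->
  (forall s, a <= s <= b -> chart_ball (beta s)) \/
  exists s, [/\ a <= s <= b,
    (forall s', a <= s' <= s -> chart_cball (beta s')) &
    r <= `|cmap (A i) (beta s) - u0|].
Proof.
move=> /within_continuousP cb ba.
have [|] := pselect (forall s, a <= s <= b -> chart_ball (beta s)).
  by left.
move=> /existsNP[s1 /not_implyP[s1ab ns1]]; right.
pose S := [set s | a <= s <= b /\ ~ chart_ball (beta s)].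
have S1 : S s1 by [].
have lbS : lbound S a by move=> s [/andP[]].
have infS : has_inf S by split; [exists s1|exists a].
(* the first time at which the path is outside the open ball *)
set t := inf S.
have at_ : a <= t by apply: lb_le_inf => //; exists s1.
have tb : t <= b by rewrite (le_trans (ge_inf infS.2 S1))//; case/andP: s1ab.
have tab : `[a, b]%classic t by rewrite /= in_itv /= at_.
have before s : a <= s < t -> chart_ball (beta s).
  move=> /andP[as_ st]; apply: contrapT => ns.
  have /(ge_inf infS.2) : S s by split=> //; rewrite as_ (le_trans (ltW st)).
  by rewrite leNgt st.
have nt : ~ chart_ball (beta t).
  move=> tV.
  have V : nbhs (beta t) chart_ball.
    by apply: open_nbhs_nbhs; split=> //; exact: chart_ball_open.
  have : nbhs t [set s | `[a, b]%classic s -> chart_ball (beta s)] :=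
    cb t tab _ V.
  move=> /nbhs_ballP[e /= e0 he].
  have [s [sab ns] ste] := inf_adherent e0 infS.
  apply/ns/he; last by rewrite /= in_itv.
  have ts : t <= s by apply: (ge_inf infS.2).
  by rewrite /ball /= distrC ger0_norm ?subr_ge0// ltrBlDl.
have tK : chart_cball (beta t).
  apply: contrapT => nK.
  have V : nbhs (beta t) (~` chart_cball).
    apply: open_nbhs_nbhs; split=> //.
    by apply: closed_openC; exact: chart_cball_closed.
  have : nbhs t [set s | `[a, b]%classic s -> (~` chart_cball) (beta s)] :=
    cb t tab _ V.
  move=> /nbhs_ballP[e /= e0 he].
  have at' : a < t.
    by rewrite lt_neqAle at_ andbT; apply/eqP => ta; apply: nt; rewrite -ta.
  pose s := Num.max a (t - e / 2).
  have st : s < t by rewrite gt_max at' ltrBlDr ltrDl divr_gt0.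
  have as_ : a <= s by rewrite /s le_max lexx.
  apply: (he s); last by apply/chart_ballW/before; rewrite as_.
    rewrite /ball /= ger0_norm ?subr_ge0 ?(ltW st)// ltrBlDl -ltrBlDr lt_max.
    by rewrite ltrD2l ltrN2 ltr_pdivrMr// ltr_pMr// ltr1n orbT.
  by rewrite /= in_itv /= as_ (le_trans (ltW st)).
exists t; split; first by rewrite at_.
  move=> s /andP[as_]; rewrite le_eqVlt => /orP[/eqP -> //|st].
  by apply/chart_ballW/before; rewrite as_.
by rewrite leNgt; apply/negP => tr; apply: nt; split=> //; case: tK.
Qed.

End chart_balls.

Section local.
Context {R : realType} (M : smoothManifold R).
Local Notation A := (@matlas R M).
Local Notation rV := 'rV[R]_(mdim M).
Variable F : forall x : M, tangent x -> R.
Arguments F : clear implicits.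
Hypothesis hF : finsler_structure F.
Variables (i : mindex M) (p : M).
Hypothesis pi : cdom (A i) p.
Local Notation N := (chart_norm F i p).
Local Notation u0 := (cmap (A i) p).
Implicit Types (beta : R -> M) (a b s : R).

Lemma chart_norm_radius e : 0 < e ->
  exists2 r, 0 < r & forall u, `|u - u0| <= r -> ccod (A i) u /\
    forall v, `|chart_norm F i (cinv (A i) u) v - N v| <= e * N v.
Proof.
move=> e0.
have [r /= r0 hr] := (nbhs_ballP _ _).1 (filterI (ccod_nbhs (cmap_ccod pi))
  (chart_norm_near hF pi e0)).
exists (r / 2) => [|u ur]; first by rewrite divr_gt0.
apply: hr; rewrite -ball_normE /= distrC (le_lt_trans ur)//.
by rewrite ltr_pdivrMr// ltr_pMr// ltr1n.
Qed.

Section radius.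
Variables (e r : R).
Hypotheses (e01 : 0 < e < 1) (r0 : 0 < r).
Hypothesis hr : forall u, `|u - u0| <= r -> ccod (A i) u /\
    forall v, `|chart_norm F i (cinv (A i) u) v - N v| <= e * N v.

Lemma chart_cball_norm x (v : tangent x) : chart_cball i u0 r x ->
  (1 - e) * N (tcoord v i) <= F x v.
Proof.
move=> [xi /hr[_ /(_ (tcoord v i))]]; rewrite cmapK// chart_normE//.
by rewrite ler_norml; lra.
Qed.

Lemma path_length_chord beta a b : pw_C1 beta a b ->
  (forall s, a <= s <= b -> chart_cball i u0 r (beta s)) ->
  (((1 - e) * N (cmap (A i) (beta b) - cmap (A i) (beta a)))%:E <=
   path_length F beta a b)%E.
Proof.
have /andP[_ e1] := e01; move=> h hK; have e1' : 0 <= 1 - e by lra.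
apply: (chord_le hF (N := fun v => (1 - e) * N v)) => //.
- move=> v.
  exact: (cvgM (cvg_cst (1 - e)) (@chart_norm_continuous _ _ _ hF _ _ pi v)).
- by move=> v w; rewrite -mulrDr ler_wpM2l// chart_norm_subadd.
- by move=> l v l0; rewrite chart_norm_hom// mulrCA.
- move=> s sab; split; first by have [] := hK s sab.
  by move=> v; apply: chart_cball_norm; exact: hK.
Qed.

Variable m : R.
Hypothesis m0 : 0 < m.
Hypothesis hm : forall v, m * `|v| <= N v.

(** A path that leaves the ball has length at least [1 - e] times the norm of
    the chord up to its exit, and that norm is at least [m] times the distance
    from the starting point to the boundary sphere. *)
Lemma path_length_exit beta a b : {within `[a, b]%classic, continuous beta} ->
  pw_C1 beta a b -> chart_ball i u0 r (beta a) ->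
  chart_ball i u0 r (beta b) /\
    (((1 - e) * N (cmap (A i) (beta b) - cmap (A i) (beta a)))%:E <=
     path_length F beta a b)%E \/
  (((1 - e) * (m * (r - `|cmap (A i) (beta a) - u0|)))%:E <=
   path_length F beta a b)%E.
Proof.
have /andP[_ e1] := e01; move=> cb h ba; have ab := pw_C1_le h.
have hr' u : `|u - u0| <= r -> ccod (A i) u by move=> /hr[].
have [hV|[s [sab hK rs]]] := chart_ball_exit hr' cb ba.
  left; split; first by apply: hV; rewrite ab lexx.
  by apply: path_length_chord => // s /hV /chart_ballW.
right; have [h1 h2] := pw_C1_split sab h.
rewrite (path_length_cat hF sab h).
apply: le_trans (leeDl _ (path_length_ge0 hF beta s b)).
apply: le_trans (path_length_chord h1 hK).
rewrite lee_fin ler_pM2l; last by lra.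
apply: le_trans (hm _); rewrite ler_pM2l//.
have -> : cmap (A i) (beta s) - cmap (A i) (beta a) =
  (cmap (A i) (beta s) - u0) - (cmap (A i) (beta a) - u0).
  by rewrite opprB addrA subrK.
by apply: le_trans (lerB_dist _ _); rewrite lerB.
Qed.

End radius.

(** Near [p] the Finsler distance is, up to a factor close to 1, given by the
    weak norm of the tangent space at [p]. *)
Lemma finsler_dist_local e : 0 < e < 1 ->
  exists2 U, nbhs p U & forall x y, U x -> U y ->
    (((1 - e) * N (cmap (A i) y - cmap (A i) x))%:E <= finsler_dist F x y)%E /\
    (finsler_dist F x y <= ((1 + e) * N (cmap (A i) y - cmap (A i) x))%:E)%E.
Proof.
move=> e01; have /andP[e0 e1] := e01.
have [r r0 hr] := chart_norm_radius e0.
have [m m0 hm] := norm_lower_bound (chart_norm_continuous hF pi)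
  (fun l v => chart_norm_hom hF v pi) (fun v => chart_norm_gt0 hF pi).
have [K K0 hK] := norm_upper_bound (chart_norm_continuous hF pi)
  (fun l v => chart_norm_hom hF v pi).
(* Chords between points of the ball of radius [q] have norm at most
   [K * (2 * q)], and leaving the ball of radius [r] costs at least
   [m * (r - q)], up to the factor [1 - e]; [q] makes the two equal. *)
pose q := m * r / (2 * K + m).
have D0 : 0 < 2 * K + m by lra.
have q0 : 0 < q by rewrite divr_gt0// mulr_gt0.
have qE : K * (2 * q) = m * (r - q).
  by rewrite /q; field; rewrite gt_eqF.
have qr : q < r.
  have : 0 < m * (r - q) by rewrite -qE mulr_gt0//; lra.
  by rewrite pmulr_rgt0// subr_gt0.
exists (chart_ball i u0 q).
  apply: open_nbhs_nbhs; split; first exact: chart_ball_open.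
  by split=> //; rewrite subrr normr0.
move=> x y [xi xq] [yi yq]; split.
  apply: (finsler_dist_lb hF) => beta a b cb h bx by_.
  have xV : chart_ball i u0 r (beta a).
    by rewrite bx; split=> //; exact: lt_trans qr.
  have := path_length_exit e01 hr m0 hm cb h xV; rewrite bx by_ => -[[]//|].
  apply: le_trans; rewrite lee_fin ler_pM2l; last by lra.
  apply: (le_trans (hK _)); apply: (@le_trans _ _ (K * (2 * q))).
    rewrite ler_pM2l//.
    have -> : cmap (A i) y - cmap (A i) x =
      (cmap (A i) y - u0) - (cmap (A i) x - u0) by rewrite opprB addrA subrK.
    by apply: le_trans (ler_normB _ _) _; lra.
  by rewrite qE ler_pM2l// lerB// ltW.
pose w := cmap (A i) y - cmap (A i) x.
have seg_in s : 0 <= s <= 1 -> `|cmap (A i) x + s *: w - u0| <= r.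
  move=> /andP[s0 s1]; have -> : cmap (A i) x + s *: w - u0 =
    (1 - s) *: (cmap (A i) x - u0) + s *: (cmap (A i) y - u0).
    by apply/matrixP => k l; rewrite !mxE; ring.
  apply: le_trans (ler_normD _ _) _; rewrite !normrZ !ger0_norm; try lra.
  nra.
have := @finsler_dist_segment R M F hF i (cmap (A i) x) w _ ((1 + e) * N w).
have -> : cmap (A i) x + w = cmap (A i) y by rewrite /w addrC subrK.
rewrite !cmapK//; apply.
  by move=> s /seg_in /hr[].
move=> s /seg_in /hr[_ /(_ w)]; rewrite ler_norml -/w /chart_norm; lra.
Qed.

(** A path to another point stays in a small ball around [p], and then its
    chord is not zero, or it leaves the ball. *)
Lemma finsler_dist_gt0 y : p <> y -> (0 < finsler_dist F p y)%E.
Proof.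
move=> py; have e01 : 0 < (2^-1 : R) < 1 by lra.
have e0 : 0 < (2^-1 : R) by lra.
have [r r0 hr] := chart_norm_radius e0.
have [m m0 hm] := norm_lower_bound (chart_norm_continuous hF pi)
  (fun l v => chart_norm_hom hF v pi) (fun v => chart_norm_gt0 hF pi).
pose c := if pselect (cdom (A i) y) then
  Num.min (N (cmap (A i) y - u0)) (m * r) else m * r.
have c0 : 0 < c.
  rewrite /c; case: pselect => yi; last by rewrite mulr_gt0.
  rewrite lt_min mulr_gt0// andbT chart_norm_gt0// subr_eq0.
  by apply/eqP => yp; apply: py; rewrite -(cmapK pi) -yp cmapK.
apply: (@lt_le_trans _ _ ((1 - 2^-1) * c)%:E).
  by rewrite lte_fin mulr_gt0//; lra.
apply: (finsler_dist_lb hF) => beta a b cb h bx by_.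
have pV : chart_ball i u0 r (beta a).
  by rewrite bx; split=> //; rewrite subrr normr0.
have := path_length_exit e01 hr m0 hm cb h pV; rewrite bx by_ => -[[[yi _]]|].
  apply: le_trans; rewrite lee_fin ler_pM2l; last by lra.
  by rewrite /c; case: pselect => // yi'; rewrite ge_min lexx.
apply: le_trans; rewrite lee_fin ler_pM2l; last by lra.
rewrite subrr normr0 subr0 /c; case: pselect => // yi.
by rewrite ge_min lexx orbT.
Qed.

End local.

(** * The asymmetric combination *)

Lemma le_of_ratio (R : realType) (x y : R) : 0 <= x -> 0 <= y ->
  (forall e, 0 < e < 1 -> (1 - e) * x <= (1 + e) * y) -> x <= y.
Proof.
move=> x0 y0 h; rewrite leNgt; apply/negP => yx.
have xy0 : 0 < 2 * (x + y) by lra.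
pose e := (x - y) / (2 * (x + y)).
have ee : e * (2 * (x + y)) = x - y by rewrite /e divfK// gt_eqF.
have e01 : 0 < e < 1.
  by rewrite /e divr_gt0 ?subr_gt0//= ltr_pdivrMr// mul1r; lra.
by have := h e e01; lra.
Qed.

Section asymmetric.
Context {R : realType} (M : smoothManifold R).
Variable F : forall x : M, tangent x -> R.
Arguments F : clear implicits.
Hypothesis hF : finsler_structure F.
Variable t : R.
Hypothesis t01 : 0 <= t <= 1.
Local Notation d := (finsler_dist F).
Local Notation Ft := (@asym_structure R M t F).
Local Notation dt := (finsler_dist Ft).

Lemma asym_structure_finsler : finsler_structure Ft.
Proof.
have /andP[t0 t1] := t01; have t1' : 0 <= 1 - t by rewrite subr_ge0.
split.
- move=> x v; apply: addr_ge0; apply: mulr_ge0 => //; exact: finsler_ge0.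
- move=> w.
  have c1 := @finsler_continuous _ _ _ hF w.
  have c2 := cvg_comp _ _ (@bundle_opp_continuous R M w)
    (@finsler_continuous _ _ _ hF (TangentVector (- tvec w))).
  have FF := nbhs_filter w.
  have d1 := @cvgM _ _ _ FF _ _ _ _ (@cvg_cst _ (1 - t) _ _ FF) c1.
  have d2 := @cvgM _ _ _ FF _ _ _ _ (@cvg_cst _ t _ _ FF) c2.
  exact: (@cvgD _ _ _ _ FF _ _ _ _ d1 d2).
- move=> x v w; rewrite /asym_structure opprD addrACA -!mulrDr.
  by apply: lerD; apply: ler_wpM2l => //; exact: finsler_subadditive.
- move=> x l v l0; rewrite /asym_structure -scalerN !(finsler_homogeneous hF)//.
  by ring.
- move=> x v; split=> [|->]; last first.
    by rewrite /asym_structure oppr0 (finsler_eq0 hF 0).2// !mulr0 addr0.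
  have a0 : 0 <= (1 - t) * F x v by apply: mulr_ge0 => //; exact: finsler_ge0.
  have b0 : 0 <= t * F x (- v) by apply: mulr_ge0 => //; exact: finsler_ge0.
  move=> /eqP; rewrite /asym_structure paddr_eq0// !mulf_eq0.
  have [->|tn0] := eqVneq t 0.
    by rewrite subr0 oner_eq0 /= => /andP[/eqP/(finsler_eq0 hF)].
  by move=> /andP[_ /eqP/(finsler_eq0 hF)/eqP]; rewrite oppr_eq0 => /eqP.
Qed.

Lemma asym_chart_norm i x v : cdom (matlas i) x ->
  chart_norm Ft i x v =
  (1 - t) * chart_norm F i x v + t * chart_norm F i x (- v).
Proof. by move=> xi; rewrite /chart_norm /asym_structure coord_vectorN. Qed.

Hypothesis d_fin : forall x y, d x y \is a fin_num.
(* Real-valued versions of [d] and of the combined metric. *)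
Let D x y := fine (d x y).
Let DE x y : d x y = (D x y)%:E. Proof. by rewrite fineK. Qed.
Let T x y := (1 - t) * D x y + t * D y x.

Let D_ge0 x y : 0 <= D x y.
Proof. by rewrite -lee_fin -DE finsler_dist_ge0. Qed.

Let D_triangle x y z : D x z <= D x y + D y z.
Proof. by rewrite -lee_fin EFinD -!DE finsler_dist_triangle. Qed.

Lemma asym_metricE x y : asym_metric t d x y = (T x y)%:E.
Proof. by rewrite /asym_metric !DE -!EFinM -EFinD. Qed.

Lemma asym_ge0 x y : 0 <= T x y.
Proof.
have /andP[t0 t1] := t01.
by rewrite addr_ge0// mulr_ge0// subr_ge0.
Qed.

Lemma asym_triangle x y z : T x z <= T x y + T y z.
Proof.
have /andP[t0 t1] := t01.
have := D_triangle x y z; have := D_triangle z y x; rewrite /T => h1 h2.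
have := ler_wpM2l t0 h1; have t1' : 0 <= 1 - t by rewrite subr_ge0.
by have := ler_wpM2l t1' h2; rewrite !mulrDr; lra.
Qed.

Lemma asym_refl x : T x x = 0.
Proof. by rewrite /T /D finsler_dist_refl// !mulr0 addr0. Qed.

Lemma asym_metric_is_metric : is_metric (asym_metric t d).
Proof.
split=> [x y|x y|x y|x y z]; rewrite ?asym_metricE//.
- by rewrite lee_fin asym_ge0.
- split=> [[T0]|->]; last by rewrite asym_refl.
  have /andP[t0 t1] := t01.
  have D_gt0 u v : u <> v -> 0 < D u v.
    move=> uv; have [i ui] := mcover u.
    by rewrite -lte_fin -DE (finsler_dist_gt0 hF ui uv).
  apply: contrapT => xy; suff : 0 < T x y by rewrite T0 ltxx.
  have Dxy := D_gt0 _ _ xy.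
  have Dyx : 0 < D y x by apply: D_gt0 => yx; exact: xy.
  rewrite /T; have [->|tn0] := eqVneq t 0; first by lra.
  have t0' : 0 < t by rewrite lt_neqAle eq_sym tn0.
  have h2 := mulr_gt0 t0' Dyx.
  have h1 : 0 <= (1 - t) * D x y by rewrite mulr_ge0 ?subr_ge0 ?(ltW Dxy).
  by lra.
- by rewrite -EFinD lee_fin asym_triangle.
Qed.

(** The combination [T] and the distance of [Ft] agree near every point up to
    a factor close to 1: both are close to the weak norm of [Ft] at that
    point. *)
Lemma asym_local (e : R) (p : M) : 0 < e < 1 ->
  exists2 U, nbhs p U & forall x y, U x -> U y ->
    (((1 - e) * T x y)%:E <= (1 + e)%:E * dt x y)%E /\
    ((1 - e)%:E * dt x y <= ((1 + e) * T x y)%:E)%E.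
Proof.
move=> e01; have [i pi] := mcover p; have /andP[e0 e1] := e01.
have [U pU hU] := finsler_dist_local hF pi e01.
have [W pW hW] := finsler_dist_local asym_structure_finsler pi e01.
exists (U `&` W); first exact: filterI.
move=> x y [Ux Wx] [Uy Wy]; have [l1 l2] := hW x y Wx Wy.
have [] := hU x y Ux Uy; have [] := hU y x Uy Ux.
rewrite !DE !lee_fin -(opprB (cmap (matlas i) y) (cmap (matlas i) x)).
move: l1 l2; rewrite asym_chart_norm//.
set w := cmap (matlas i) y - cmap (matlas i) x.
set a := chart_norm F i p w; set b := chart_norm F i p (- w).
move=> l1 l2 byx byx' bxy bxy'.
have /andP[t0 t1] := t01; have t1' : 0 <= 1 - t by rewrite subr_ge0.
have Tlb : (1 - e) * ((1 - t) * a + t * b) <= T x y.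
  by have := ler_wpM2l t0 byx; have := ler_wpM2l t1' bxy; rewrite /T; lra.
have Tub : T x y <= (1 + e) * ((1 - t) * a + t * b).
  by have := ler_wpM2l t0 byx'; have := ler_wpM2l t1' bxy'; rewrite /T; lra.
have e1' : 0 <= 1 - e by lra.
have e0' : 0 <= 1 + e by lra.
split.
  apply: (@le_trans _ _ ((1 + e)%:E * ((1 - e) * ((1 - t) * a + t * b))%:E)%E).
    rewrite -EFinM lee_fin mulrCA; exact: ler_wpM2l.
  by apply: lee_wpmul2l; rewrite ?lee_fin.
apply: (@le_trans _ _ ((1 - e)%:E * ((1 + e) * ((1 - t) * a + t * b))%:E)%E).
  by apply: lee_wpmul2l; rewrite ?lee_fin.
by rewrite -EFinM lee_fin mulrCA; exact: ler_wpM2l.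
Qed.

(** The inequality holds up to the factor [(1 - e) / (1 + e)] on short pieces
    of the path, and passes to the whole path because the length is additive
    and [T] satisfies the triangle inequality. *)
Lemma asym_le_path beta a b : {within `[a, b]%classic, continuous beta} ->
  pw_C1 beta a b -> ((T (beta a) (beta b))%:E <= path_length Ft beta a b)%E.
Proof.
move=> cb h; have hFt := asym_structure_finsler; have ab := pw_C1_le h.
have key e : 0 < e < 1 ->
  (((1 - e) * T (beta a) (beta b))%:E <=
   (1 + e)%:E * path_length Ft beta a b)%E.
  move=> e01; have /andP[e0 e1] := e01; have e0' : 0 <= 1 + e by lra.
  pose P s := (((1 - e) * T (beta a) (beta s))%:E <=
    (1 + e)%:E * path_length Ft beta a s)%E.
  apply: (@real_induction R P a b ab).
    by rewrite /P asym_refl mulr0 mule_ge0 ?lee_fin// path_length_ge0.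
  move=> s0 s0ab; have [U sU hU] := asym_local (beta s0) e01.
  have s0ab' : `[a, b]%classic s0 by rewrite /= in_itv.
  have H : nbhs s0 [set s | `[a, b]%classic s -> U (beta s)] :=
    (within_continuousP _ _).1 cb s0 s0ab' _ sU.
  have [r /= r0 hr] := (nbhs_ballP _ _).1 H.
  have step s1 s2 : a <= s1 -> s1 <= s2 -> s2 <= b ->
      U (beta s1) -> U (beta s2) -> P s1 -> P s2.
    move=> as1 s12 s2b U1 U2; rewrite /P => P1.
    have as2 : a <= s1 <= s2 by rewrite as1.
    have as2b : a <= s2 <= b by rewrite (le_trans as1 s12).
    have as1b : a <= s1 <= b by rewrite as1 (le_trans s12 s2b).
    have [h02 _] := pw_C1_split as2b h.
    have [_ h12] := pw_C1_split as2 h02.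
    rewrite (path_length_cat hFt as2 h02).
    rewrite ge0_muleDr ?path_length_ge0//.
    have c12 : {within `[s1, s2]%classic, continuous beta}.
      apply: continuous_subspaceW cb => s; rewrite /= !in_itv /= => /andP[? ?].
      by apply/andP; split; lra.
    have l12 : (((1 - e) * T (beta s1) (beta s2))%:E <=
        (1 + e)%:E * path_length Ft beta s1 s2)%E.
      apply: le_trans (hU _ _ U1 U2).1 _.
      apply: lee_wpmul2l; rewrite ?lee_fin//.
      exact: finsler_dist_le_path.
    apply: le_trans (leeD P1 l12); rewrite -EFinD lee_fin -mulrDr ler_wpM2l//.
      by lra.
    exact: asym_triangle.
  have s0U : U (beta s0) by exact: nbhs_singleton.
  exists r => // s sab ss0.
  have sU' : U (beta s) by apply: (hr s); rewrite /ball /= ?in_itv// distrC.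
  have /andP[? ?] := s0ab; have /andP[? ?] := sab.
  by split=> ?; apply: step.
have := path_length_ge0 hFt beta a b; move: key.
case: (path_length _ _ _ _) => [l| |] key //; rewrite ?leey// !lee_fin => l0.
by apply: le_of_ratio => //; exact: asym_ge0.
Qed.

Lemma asym_le_dist x y : ((T x y)%:E <= dt x y)%E.
Proof.
apply: (finsler_dist_lb asym_structure_finsler) => beta a b cb h <- <-.
exact: asym_le_path.
Qed.

(** The triangle inequality for [a], [s], [s'] is an equality along a
    geodesic. *)
Lemma geodesic_additive a b gamma s s' : geodesic F a b gamma ->
  a <= s -> s <= s' -> s' <= b ->
  D (gamma a) (gamma s) + D (gamma s) (gamma s') <= D (gamma a) (gamma s').
Proof.
move=> [_ _ gE] as_ ss' sb'.
(* the partition a, s, s', b, where b is the default value of [nth] *)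
pose p k := nth b [:: a; s; s'] k.
have : (\sum_(k < 3) d (gamma (p k)) (gamma (p k.+1)) <=
    d (gamma a) (gamma b))%E.
  rewrite -gE; apply: ereal_sup_ubound; exists 2%N, p; split=> //.
  by case=> [|[|[|]]].
rewrite !big_ord_recr big_ord0 /= add0e /p /= !DE -!EFinD lee_fin.
by have := D_triangle (gamma a) (gamma s') (gamma b); lra.
Qed.

Lemma bi_geodesic_additive a b gamma s s' : bi_geodesic F a b gamma ->
  a <= s -> s <= s' -> s' <= b ->
  T (gamma a) (gamma s) + T (gamma s) (gamma s') <= T (gamma a) (gamma s').
Proof.
move=> [g1 g2] as_ ss' sb'.
have h1 := geodesic_additive g1 as_ ss' sb'.
have h2 :
  D (gamma s') (gamma s) + D (gamma s) (gamma a) <= D (gamma s') (gamma a).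
  have [_ _ gE] := g2; rewrite /reverse_path in gE.
  pose p k := nth b [:: a; a + b - s'; a + b - s] k.
  have e1 : a + b - a = b by ring.
  have e2 : a + b - (a + b - s') = s' by ring.
  have e3 : a + b - (a + b - s) = s by ring.
  have e4 : a + b - b = a by ring.
  have : (\sum_(k < 3) d (gamma (a + b - p k)%R) (gamma (a + b - p k.+1)%R) <=
      d (gamma b) (gamma a))%E.
    move: gE; rewrite e1 e4 => <-.
    apply: ereal_sup_ubound; exists 2%N, p; split=> //.
    by case=> [|[|[|]]]//= _; rewrite /p /=; lra.
  rewrite !big_ord_recr big_ord0 /= add0e /p /= e1 e2 e3 e4 !DE -!EFinD lee_fin.
  by have := D_triangle (gamma b) (gamma s') (gamma a); lra.
have /andP[t0 t1] := t01; have t1' : 0 <= 1 - t by rewrite subr_ge0.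
have := ler_wpM2l t0 h2; have := ler_wpM2l t1' h1.
by rewrite /T; lra.
Qed.

(** The converse of [asym_le_dist] at the ends of a bi-geodesic: along it [T] is
    additive and the distance of [Ft] satisfies the triangle inequality. *)
Lemma dist_le_asym a b gamma : a <= b -> bi_geodesic F a b gamma ->
  (dt (gamma a) (gamma b) <= (T (gamma a) (gamma b))%:E)%E.
Proof.
move=> ab g; have [[cg _ _] _] := g; have hFt := asym_structure_finsler.
have key e : 0 < e < 1 -> ((1 - e)%:E * dt (gamma a) (gamma b) <=
    ((1 + e) * T (gamma a) (gamma b))%:E)%E.
  move=> e01; have /andP[e0 e1] := e01; have e1' : 0 <= 1 - e by lra.
  pose P s := ((1 - e)%:E * dt (gamma a) (gamma s) <=
    ((1 + e) * T (gamma a) (gamma s))%:E)%E.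
  apply: (@real_induction R P a b ab).
    by rewrite /P finsler_dist_refl// asym_refl mule0 mulr0.
  move=> s0 s0ab; have [U sU hU] := asym_local (gamma s0) e01.
  have s0ab' : `[a, b]%classic s0 by rewrite /= in_itv.
  have H : nbhs s0 [set s | `[a, b]%classic s -> U (gamma s)] :=
    (within_continuousP _ _).1 cg s0 s0ab' _ sU.
  have [r /= r0 hr] := (nbhs_ballP _ _).1 H.
  have step s1 s2 : a <= s1 -> s1 <= s2 -> s2 <= b ->
      U (gamma s1) -> U (gamma s2) -> P s1 -> P s2.
    move=> as1 s12 s2b U1 U2; rewrite /P => P1.
    apply: (@le_trans _ _ ((1 - e)%:E *
      (dt (gamma a) (gamma s1) + dt (gamma s1) (gamma s2)))%E).
      by apply: lee_wpmul2l; rewrite ?lee_fin//; exact: finsler_dist_triangle.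
    rewrite ge0_muleDr ?finsler_dist_ge0//.
    apply: le_trans (leeD P1 (hU _ _ U1 U2).2) _.
    rewrite -EFinD lee_fin -mulrDr ler_wpM2l//; first by lra.
    exact: bi_geodesic_additive g as1 s12 s2b.
  have s0U : U (gamma s0) by exact: nbhs_singleton.
  exists r => // s sab ss0.
  have sU' : U (gamma s) by apply: (hr s); rewrite /ball /= ?in_itv// distrC.
  have /andP[? ?] := s0ab; have /andP[? ?] := sab.
  by split=> ?; apply: step.
have := finsler_dist_ge0 hFt (gamma a) (gamma b); move: key.
case: (dt _ _) => [l| |] key //.
  rewrite !lee_fin => l0; apply: (le_of_ratio l0 (asym_ge0 _ _)) => e /key.
  by rewrite -EFinM lee_fin.
have e01 : 0 < (2^-1 : R) < 1 by lra.
by have := key _ e01; rewrite gt0_muley ?lte_fin ?leye_eq//; lra.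
Qed.

Lemma asym_metric_eq_dist a b gamma : a <= b -> bi_geodesic F a b gamma ->
  asym_metric t d (gamma a) (gamma b) = dt (gamma a) (gamma b).
Proof.
move=> ab g; rewrite asym_metricE; apply/eqP.
by rewrite eq_le asym_le_dist dist_le_asym.
Qed.

(** By additivity of [T], no partition sum exceeds the distance between the
    endpoints. *)
Lemma bi_geodesic_asym a b gamma : a <= b ->
  (forall x y, asym_metric t d x y = dt x y) ->
  bi_geodesic F a b gamma -> geodesic Ft a b gamma.
Proof.
move=> ab dtE' g; have [[cg _ _] _] := g.
have dtE x y : dt x y = (T x y)%:E by rewrite -dtE' asym_metricE.
have E : metric_length dt a b gamma = dt (gamma a) (gamma b).
  apply/eqP; rewrite eq_le; apply/andP; split.
    apply: ge_ereal_sup => _ [k [p [p0 pk hp ->]]].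
    have pa j : (j <= k.+1)%N -> a <= p j.
      elim: j => [|j IH jk]; first by rewrite p0.
      by apply: le_trans (IH (ltnW jk)) (hp j _).
    have pb j : (j <= k.+1)%N -> p (k.+1 - j)%N <= b.
      elim: j => [|j IH jk]; first by rewrite subn0 pk.
      apply: le_trans (IH (ltnW jk)).
      by rewrite subSS subSn//; apply: hp; exact: leq_subr.
    have key j : (j <= k.+1)%N ->
        (\sum_(i < j) dt (gamma (p i)) (gamma (p i.+1)) <=
         (T (gamma a) (gamma (p j)))%:E)%E.
      elim: j => [|j IH jk]; first by rewrite big_ord0 lee_fin asym_ge0.
      rewrite big_ord_recr /=.
      apply: le_trans (leeD (IH (ltnW jk)) (le_refl _)) _.
      rewrite dtE -EFinD lee_fin.
      apply: bi_geodesic_additive g _ _ _; [exact/pa/ltnW|exact: hp|].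
      by have := pb (k.+1 - j.+1)%N (leq_subr _ _); rewrite subKn.
    by have := key k.+1 (leqnn _); rewrite pk -dtE.
  apply: ereal_sup_ubound; exists 0%N, (fun i => if i is 0%N then a else b).
  by split=> //; [case|rewrite big_ord_recr big_ord0 /= add0e].
by split=> //; rewrite E dtE ltry.
Qed.

End asymmetric.

Lemma bi_geodesic_reverse (R : realType) (M : smoothManifold R)
    (F : forall x : M, tangent x -> R) (a b : R) (gamma : R -> M) :
  bi_geodesic F a b gamma -> bi_geodesic F a b (reverse_path a b gamma).
Proof.
move=> [g1 g2]; split=> //.
suff -> : reverse_path a b (reverse_path a b gamma) = gamma by [].
by apply/funext => s; rewrite /reverse_path; congr gamma; ring.
Qed.

Unset Implicit Arguments.
Set Strict Implicit.
Set Printing Implicit Defensive.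

Theorem theorem5p3 (R : realType) (M : smoothManifold R)
    (F : forall x : M, tangent x -> R)
    (hF : finsler_structure F)
    (hgeo : forall x y : M, exists (a b : R) (gamma : R -> M),
       [/\ a <= b, abs_continuous_path a b gamma, bi_geodesic F a b gamma,
           gamma a = x & gamma b = y])
    (t : R) (ht : 0 <= t <= 1) :
  [/\ (forall x y : M, asym_metric t (finsler_dist F) x y =
                       finsler_dist (asym_structure t F) x y),
      finsler_metric_with_lagrangian (asym_metric t (finsler_dist F))
                                     (asym_structure t F) &
      forall (a b : R) (gamma : R -> M), a <= b ->
        abs_continuous_path a b gamma -> bi_geodesic F a b gamma ->
        bi_geodesic (asym_structure t F) a b gamma].
Proof.
have dfin x y : finsler_dist F x y \is a fin_num.
  have [a [b [gamma [_ _ [[_ l lE] _] <- <-]]]] := hgeo x y.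
  by rewrite ge0_fin_numE ?finsler_dist_ge0// -lE.
have E x y : asym_metric t (finsler_dist F) x y =
    finsler_dist (asym_structure t F) x y.
  have [a [b [gamma [ab _ g <- <-]]]] := hgeo x y.
  exact: asym_metric_eq_dist.
split=> //.
  split=> //; first exact: asym_metric_is_metric.
  exact: asym_structure_finsler.
move=> a b gamma ab _ g; split; apply: bi_geodesic_asym => //.
exact: bi_geodesic_reverse.
Qed.
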